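(* Let $(\Omega,\Sigma,\mu)$ and $(\Delta,\Gamma,\nu)$ be $\sigma$-finite measure spaces, let $X_1(\mu),X_2(\mu)$ be saturated Banach function spaces over $\mu$ and $Y_1(\nu),Y_2(\nu)$ saturated Banach function spaces over $\nu$, and let $T\colon X_1(\mu)\to Y_1(\nu)$ and $S\colon X_2(\mu)\to Y_2(\nu)$ be nontrivial continuous linear operators. Assume that $Y_1(\nu)'$ has a Schauder basis $(\gamma_n)$ and $X_1(\mu)$ has a Schauder basis $(\beta_n)$. Assume that $Y_2^{Y_1''}$ is saturated and that $Y_2(\nu)$ or $Y_1(\nu)'$ is $\sigma$-order continuous. Given $h\in X_1^{X_2}$, the following are equivalent: (a) $T$ factors strongly through $S$ and $M_h$, i.e. there exists $g\in Y_2^{Y_1''}$ with $T(x)=g\,S(hx)$ for all $x\in X_1(\mu)$. (b) There exists $g\in Y_2^{Y_1''}$ such that $T(\beta_n)=g\,S(h\beta_n)$ for each $n\in\mathbb{N}$. (c) There exists $C>0$ such that $$\sum_{i=1}^n\sum_{j=1}^m r_{ij}\int T(\beta_j)\gamma_i\,d\nu\le C\Big\Vert\sum_{i=1}^n\sum_{j=1}^m r_{ij}S(h\beta_j)\gamma_i\Big\Vert_{Y_2\pi Y_1'}$$ for all $n,m\in\mathbb{N}$ and all real $(r_{ij})$ with $|r_{ij}|\le1$. Moreover, if $Y_2(\nu)\subset Y_1(\nu)''$ and the functions $(\gamma_n)$ have pairwise disjoint supports, then the condition (d) there exists $C>0$ such that $\sum_{j=1}^m r_j\int T(\beta_j)\gamma_n\,d\nu\le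 C\int\big|\sum_{j=1}^m r_jS(h\beta_j)\gamma_n\big|\,d\nu$ for all $n,m\in\mathbb{N}$ and all real $(r_j)$ with $|r_j|\le1$ implies (a)–(c). If, in addition to these, $Y_2^{Y_1''}=L^\infty(\nu)$, then (d) is equivalent to (a)–(c).
   Context: A Banach function space $X(\mu)$ is a Banach space $X(\mu)\subset L^0(\mu)$ (measurable functions mod a.e. equality) with norm such that $|f|\le|g|$ a.e., $g\in X(\mu)$ imply $f\in X(\mu)$ and $\Vert f\Vert_X\le\Vert g\Vert_X$; it is saturated if no set $A$ of positive measure satisfies $f\chi_A=0$ a.e. for all $f\in X(\mu)$; it is $\sigma$-order continuous if $f_n\downarrow 0$ a.e. with $f_n\in X(\mu)$ implies $\Vert f_n\Vert_X\downarrow0$. $X^Y=\{h: fh\in Y\ \forall f\in X\}$ with norm $\sup_{f\in B_X}\Vert hf\Vert_Y$; $X'=X^{L^1}$ (Köthe dual), $X''=(X')'$. The $\pi$-product $X\pi Y$ is the space of $h$ with $|h|\le\sum_n|f_ng_n|$ a.e. for some $f_n\in X$, $g_n\in Y$, $\sum_n\Vert f_n\Vert_X\Vert g_n\Vert_Y<\infty$, with norm the infimum of $\sum_n\Vert f_n\Vert_X\Vert g_n\Vert_Y$. *)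

(* Defs.v *)
From HB Require Import structures.
From mathcomp Require Import all_boot all_order all_algebra.
From mathcomp Require Import all_classical all_reals all_analysis.
Set Implicit Arguments. Unset Strict Implicit. Unset Printing Implicit Defensive.
Import Order.TTheory GRing.Theory Num.Theory.
Local Open Scope classical_set_scope.
Local Open Scope ring_scope.

(* Elements of L^0(mu) are represented by functions T -> R; everything below is
   invariant under a.e.-equality (the ideal property forces this). *)

Section BFS.
Context {d : measure_display} {T : measurableType d} {R : realType}.
Variable mu : {measure set T -> \bar R}.

Record BFS := {
  bfs_mem : (T -> R) -> Prop;
  bfs_norm : (T -> R) -> R;
  bfs_meas : forall f, bfs_mem f -> measurable_fun setT f;
  bfs_mem0 : bfs_mem (fun _ => 0);
  bfs_memD : forall f g, bfs_mem f -> bfs_mem g -> bfs_mem (fun x => f x + g x);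
  bfs_memZ : forall (a : R) f, bfs_mem f -> bfs_mem (fun x => a * f x);
  bfs_norm_ge0 : forall f, bfs_mem f -> 0 <= bfs_norm f;
  bfs_norm_eq0 : forall f, bfs_mem f ->
      (bfs_norm f = 0 <-> {ae mu, forall x, f x = 0});
  bfs_normD : forall f g, bfs_mem f -> bfs_mem g ->
      bfs_norm (fun x => f x + g x) <= bfs_norm f + bfs_norm g;
  bfs_normZ : forall (a : R) f, bfs_mem f ->
      bfs_norm (fun x => a * f x) = `|a| * bfs_norm f;
  bfs_ideal : forall f g : T -> R, measurable_fun setT f -> bfs_mem g ->
      {ae mu, forall x, `|f x| <= `|g x|} ->
      bfs_mem f /\ bfs_norm f <= bfs_norm g;
  bfs_complete : forall u : nat -> T -> R, (forall n, bfs_mem (u n)) ->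
      (forall e : R, 0 < e -> exists N, forall m n, (N <= m)%N -> (N <= n)%N ->
          bfs_norm (fun x => u m x - u n x) < e) ->
      exists f, bfs_mem f /\
        (fun n => bfs_norm (fun x => u n x - f x)) @ \oo --> 0 }.

Definition saturated (mem : (T -> R) -> Prop) : Prop :=
  ~ exists A : set T, [/\ measurable A, (0 < mu A)%E &
      forall f, mem f -> {ae mu, forall x, A x -> f x = 0}].

Definition sigma_oc (mem : (T -> R) -> Prop) (nrm : (T -> R) -> \bar R) : Prop :=
  forall u : nat -> T -> R, (forall n, mem (u n)) ->
    {ae mu, forall x, (forall n, u n.+1 x <= u n x) /\ (fun n => u n x) @ \oo --> 0} ->
    (fun n => nrm (u n)) @ \oo --> 0%E.

Definition schauder_basis (mem : (T -> R) -> Prop) (nrm : (T -> R) -> \bar R)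
    (b : nat -> T -> R) : Prop :=
  (forall n, mem (b n)) /\
  forall f, mem f -> exists! a : nat -> R,
    (fun N => nrm (fun x => f x - \sum_(k < N) a k * b k x)) @ \oo --> 0%E.

Definition mulsp_mem (memX memY : (T -> R) -> Prop) (h : T -> R) : Prop :=
  measurable_fun setT h /\ forall f, memX f -> memY (fun x => h x * f x).

Definition L1_mem (f : T -> R) : Prop := mu.-integrable setT (fun x => (f x)%:E).

Definition kdual_mem (memX : (T -> R) -> Prop) := mulsp_mem memX L1_mem.

Definition kdual_norm (memX : (T -> R) -> Prop) (nrmX : (T -> R) -> \bar R)
    (h : T -> R) : \bar R :=
  ereal_sup [set (\int[mu]_x (`|h x * f x|)%:E)%E
             | f in [set f | memX f /\ (nrmX f <= 1)%E]].

Definition pi_norm (memX : (T -> R) -> Prop) (nrmX : (T -> R) -> \bar R)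
    (memY : (T -> R) -> Prop) (nrmY : (T -> R) -> \bar R) (h : T -> R) : \bar R :=
  ereal_inf [set (\sum_(0 <= n <oo) (nrmX (fg.1 n) * nrmY (fg.2 n)))%E
     | fg in [set fg : (nat -> T -> R) * (nat -> T -> R) |
        [/\ forall n, memX (fg.1 n) /\ memY (fg.2 n),
            {ae mu, forall x, ((`|h x|)%:E <=
                 \sum_(0 <= n <oo) (`|fg.1 n x * fg.2 n x|)%:E)%E} &
            (\sum_(0 <= n <oo) (nrmX (fg.1 n) * nrmY (fg.2 n)) < +oo)%E]]].

Definition Linf_mem (f : T -> R) : Prop :=
  measurable_fun setT f /\ exists M : R, {ae mu, forall x, `|f x| <= M}.

End BFS.

Definition bfs_enorm {d} {T : measurableType d} {R : realType}
  {mu : {measure set T -> \bar R}} (X : BFS mu) (f : T -> R) : \bar R :=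
  (bfs_norm X f)%:E.

Definition bdd_linop {d1 d2} {O : measurableType d1} {D : measurableType d2}
  {R : realType} {mu : {measure set O -> \bar R}} {nu : {measure set D -> \bar R}}
  (X : BFS mu) (Y : BFS nu) (Op : (O -> R) -> (D -> R)) : Prop :=
  [/\ forall f, bfs_mem X f -> bfs_mem Y (Op f),
      forall f g, bfs_mem X f -> bfs_mem X g -> {ae mu, forall x, f x = g x} ->
        {ae nu, forall y, Op f y = Op g y},
      forall (a b : R) f g, bfs_mem X f -> bfs_mem X g ->
        {ae nu, forall y, Op (fun x => a * f x + b * g x) y = a * Op f y + b * Op g y} &
      exists K : R, forall f, bfs_mem X f -> bfs_norm Y (Op f) <= K * bfs_norm X f].

Definition nontrivial_op {d1 d2} {O : measurableType d1} {D : measurableType d2}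
  {R : realType} {mu : {measure set O -> \bar R}} (nu : {measure set D -> \bar R})
  (X : BFS mu) (Op : (O -> R) -> (D -> R)) : Prop :=
  exists f, bfs_mem X f /\ ~ {ae nu, forall y, Op f y = 0}.

(* Main.v *)
Require Import Defs.
From HB Require Import structures.
From mathcomp Require Import all_boot all_order all_algebra.
From mathcomp Require Import all_classical all_reals all_analysis.
From mathcomp Require Import measurable_realfun ring lra.
Set Implicit Arguments. Unset Strict Implicit. Unset Printing Implicit Defensive.
Import Order.TTheory GRing.Theory Num.Theory.
Import numFieldNormedType.Exports.
Local Open Scope classical_set_scope.
Local Open Scope ring_scope.

(** The implication from (c) to (a) is a duality argument. By (c), the values
    [\int T(beta_j) gamma_i] are interpolated by a linear functional on the
    pi-product [Y2 pi Y1'] that is dominated by a multiple of its norm: this is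
    the theorem of Mazur and Orlicz. Since [Y2] or [Y1'] is sigma-order
    continuous, so is this functional along the products [y z], and a density
    with respect to [e e'], for weak units [e] of [Y2] and [e'] of [Y1'],
    represents it as integration against some [g], which therefore multiplies
    [Y2] into [Y1'']. As the [gamma_i] span [Y1'], which is saturated,
    [T(beta_j) = g S(h beta_j)] a.e., and (a) follows because the expansions
    along [beta] converge a.e. after passing to a subsequence.

    That the Koethe dual of a saturated space [X] is saturated rests on the same
    representation: a functional supporting the infimal convolution of the norms
    of [X] and [L1] has a density, which lies in [X']. Finiteness of dual norms
    and continuity of multiplication operators come from one gliding hump
    argument, for which it is enough that a sequence with summable norms is
    dominated by one element of the space. *)

(** * Sublinear functionals *)

Section LinearFunctionals.
Context {R : realType} {V : lmodType R}.
Implicit Types (Z : set V) (p F : V -> R).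

Definition linear_subspace Z := [/\ Z 0,
  forall x y, Z x -> Z y -> Z (x + y) & forall a x, Z x -> Z (a *: x)].

Definition sublinear_on Z p :=
  (forall x y, Z x -> Z y -> p (x + y) <= p x + p y) /\
  (forall a x, 0 <= a -> Z x -> p (a *: x) <= a * p x).

Definition linear_on Z F :=
  (forall x y, Z x -> Z y -> F (x + y) = F x + F y) /\
  (forall a x, Z x -> F (a *: x) = a * F x).

Definition minimal_sublinear_on Z p := sublinear_on Z p /\
  forall q, sublinear_on Z q -> (forall x, Z x -> q x <= p x) ->
    forall x, Z x -> p x <= q x.

Lemma linear_subspace_sum Z (I : Type) (s : seq I) (x : I -> V) :
  linear_subspace Z -> (forall i, Z (x i)) -> Z (\sum_(i <- s) x i).
Proof. by move=> [Z0 ZD _] Zx; apply: big_ind => //; exact: Z0. Qed.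

Lemma linear_on_sum Z F (I : Type) (s : seq I) (x : I -> V) :
  linear_subspace Z -> linear_on Z F -> (forall i, Z (x i)) ->
  F (\sum_(i <- s) x i) = \sum_(i <- s) F (x i).
Proof.
move=> subZ [FD FZ] Zx; have [Z0 _ _] := subZ; elim: s => [|i s IH].
  by rewrite !big_nil -[LHS](congr1 F (scale0r 0)) FZ// mul0r.
by rewrite !big_cons FD ?IH//; exact: linear_subspace_sum.
Qed.

End LinearFunctionals.

Section MazurOrlicz.
Context {R : realType} {V : lmodType R} (Z : set V).
Hypothesis subZ : linear_subspace Z.
Implicit Types (p q F : V -> R) (D : set (V * R^o)).

Let Z0 : Z 0. Proof. by case: subZ. Qed.
Let ZD x y : Z x -> Z y -> Z (x + y). Proof. by case: subZ => _ + _; exact. Qed.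
Let ZZ a x : Z x -> Z (a *: x). Proof. by case: subZ => _ _; exact. Qed.
Let ZN x : Z x -> Z (- x). Proof. by rewrite -scaleN1r; exact: ZZ. Qed.

Lemma sublinear_on0 p : sublinear_on Z p -> p 0 = 0.
Proof.
move=> [pD pZ]; have := pD _ _ Z0 Z0; have := pZ 0 0 (lexx _) Z0.
rewrite addr0 scaler0 mul0r; lra.
Qed.

Lemma sublinear_onN p x : sublinear_on Z p -> Z x -> - p (- x) <= p x.
Proof.
move=> sp Zx; have := sp.1 _ _ Zx (ZN Zx).
rewrite subrr (sublinear_on0 sp); lra.
Qed.

Lemma sublinear_onZ_ge p a x : sublinear_on Z p -> Z x -> a * p x <= p (a *: x).
Proof.
move=> sp Zx; have [a_gt0|a_le0] := ltP 0 a.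
  rewrite -ler_pdivlMl//; have := sp.2 a^-1 _ _ (ZZ a Zx).
  by rewrite scalerA mulVf ?gt_eqF// scale1r invr_ge0; apply; exact: ltW.
apply: le_trans (sublinear_onN sp (ZZ a Zx)).
by rewrite lerNr -mulNr -scaleNr; apply: sp.2 => //; rewrite oppr_ge0.
Qed.

Definition cone_below p D := [/\ D 0, forall u v, D u -> D v -> D (u + v),
  forall (a : R) u, 0 <= a -> D u -> D (a *: u) &
  forall u, D u -> Z u.1 /\ u.2 <= p u.1].

(* The largest sublinear functional q below p such that u.2 <= - q (- u.1) for
   every u in D. *)
Definition cone_inf p D z := inf [set p (z + u.1) - u.2 | u in D].

Lemma cone_inf_le p D z u : sublinear_on Z p -> cone_below p D -> Z z -> D u ->
  cone_inf p D z <= p (z + u.1) - u.2.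
Proof.
move=> sp [_ _ _ Dp] Zz Du; apply: ge_inf; last by exists u.
exists (- p (- z)) => _ [v Dv <-]; have [Zv vp] := Dp _ Dv.
have := sp.1 _ _ (ZN Zz) (ZD Zz Zv); rewrite addKr; lra.
Qed.

Lemma cone_inf_ge p D c z : D 0 ->
  (forall u, D u -> c <= p (z + u.1) - u.2) -> c <= cone_inf p D z.
Proof.
move=> D0 cp; apply: lb_le_inf; first by exists (p (z + 0) - 0), 0.
by move=> _ [u Du <-]; exact: cp.
Qed.

Lemma cone_inf_le_self p D z : sublinear_on Z p -> cone_below p D -> Z z ->
  cone_inf p D z <= p z.
Proof.
move=> sp Dp Zz; have [D0 _ _ _] := Dp.
by have := cone_inf_le sp Dp Zz D0; rewrite /= addr0 subr0.
Qed.

Lemma cone_inf_sublinear p D : sublinear_on Z p -> cone_below p D ->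
  sublinear_on Z (cone_inf p D).
Proof.
move=> sp Dp; have [D0 DD DZ DZp] := Dp; split.
  move=> x y Zx Zy; rewrite -lerBlDr; apply: cone_inf_ge => // u Du.
  rewrite lerBlDl -lerBlDr; apply: cone_inf_ge => // v Dv; rewrite lerBlDl.
  apply: le_trans (cone_inf_le sp Dp (ZD Zx Zy) (DD _ _ Du Dv)) _ => /=.
  have := sp.1 _ _ (ZD Zx (DZp _ Du).1) (ZD Zy (DZp _ Dv).1).
  rewrite addrACA; lra.
move=> a x; rewrite le_eqVlt => /predU1P[<- Zx|a_gt0 Zx].
  by rewrite scale0r mul0r -(sublinear_on0 sp); exact: cone_inf_le_self.
rewrite -ler_pdivrMl//; apply: cone_inf_ge => // u Du; rewrite ler_pdivrMl//.
apply: le_trans (cone_inf_le sp Dp (ZZ a Zx) (DZ _ _ (ltW a_gt0) Du)) _ => /=.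
rewrite -scalerDr mulrBr lerD2r; apply: sp.2; first exact: ltW.
by apply: ZD => //; case: (DZp _ Du).
Qed.

Lemma sublinear_on_chain_inf (A : set (V -> R)) p : A !=set0 ->
  (forall q, A q -> sublinear_on Z q) ->
  (forall q, A q -> forall x, Z x -> q x <= p x) ->
  (forall q r, A q -> A r -> (forall x, Z x -> q x <= r x) \/
    (forall x, Z x -> r x <= q x)) ->
  sublinear_on Z (fun x => inf [set q x | q in A]) /\
  (forall q, A q -> forall x, Z x -> inf [set q x | q in A] <= q x).
Proof.
move=> [q0 Aq0] Asub Ap Achain.
have inf_leq q x : A q -> Z x -> inf [set q x | q in A] <= q x.
  move=> Aq Zx; apply: ge_inf; last by exists q.
  exists (- p (- x)) => _ [r Ar <-].
  apply: le_trans (sublinear_onN (Asub r Ar) Zx).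
  by rewrite lerN2; apply: Ap => //; exact: ZN.
have leq_inf c x : (forall q, A q -> c <= q x) -> c <= inf [set q x | q in A].
  move=> cq; apply: lb_le_inf => [|_ [q Aq <-]]; last exact: cq.
  by exists (q0 x), q0.
split; last by move=> q Aq x; exact: inf_leq.
split=> [x y Zx Zy|a x a_ge0 Zx].
  rewrite -lerBlDr; apply: (leq_inf) => q Aq.
  rewrite lerBlDl -lerBlDr; apply: (leq_inf) => r Ar; rewrite lerBlDl.
  have [s As [sq sr]] : exists2 s, A s & s x <= q x /\ s y <= r y.
    have [qr|rq] := Achain _ _ Aq Ar; [exists q|exists r] => //; split => //.
      exact: qr.
    exact: rq.
  apply: le_trans (inf_leq s _ As (ZD Zx Zy)) _.
  by have := (Asub s As).1 _ _ Zx Zy; lra.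
have inf_le_scaled q : A q -> inf [set q (a *: x) | q in A] <= a * q x.
  move=> Aq; apply: le_trans (inf_leq q _ Aq (ZZ a Zx)) _.
  exact: (Asub q Aq).2.
move: a_ge0; rewrite le_eqVlt => /predU1P[a0|a_gt0].
  by have := inf_le_scaled _ Aq0; rewrite -a0 !mul0r.
rewrite -ler_pdivrMl//; apply: (leq_inf) => q Aq.
by rewrite ler_pdivrMl// inf_le_scaled.
Qed.

Lemma exists_minimal_sublinear p : sublinear_on Z p ->
  exists2 q, minimal_sublinear_on Z q & forall x, Z x -> q x <= p x.
Proof.
move=> sp.
pose Q := {q | sublinear_on Z q /\ forall x, Z x -> q x <= p x}.
pose above (q r : Q) := `[< forall x, Z x -> sval r x <= sval q x >].
have pQ : Q by exists p; split.
have [q|q r s|A Achain|[q [sq qp]] qmin] := @ZL_preorder Q pQ above.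
- exact/asboolP.
- move=> /asboolP rq /asboolP rs; apply/asboolP => x Zx.
  exact: le_trans (rs x Zx) (rq x Zx).
- have [->|/set0P[a Aa]] := eqVneq A set0; first by exists pQ.
  have [|q [r Ar <-]|q [r Ar <-]|_ _ [q Aq <-] [r Ar <-]|] :=
    @sublinear_on_chain_inf [set sval q | q in A] p.
  + by exists (sval a), a.
  + exact: (svalP r).1.
  + exact: (svalP r).2.
  + by have [/asboolP|/asboolP] := Achain _ _ Aq Ar; [right|left].
  set meet := (fun x => inf _) => smeet meet_le.
  suff meet_leq x : Z x -> meet x <= p x.
    exists (exist _ meet (conj smeet meet_leq)) => q Aq.
    by apply/asboolP => x; apply: meet_le; exists q.
  move=> Zx; apply: le_trans (meet_le (sval a) _ x Zx) ((svalP a).2 x Zx).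
  by exists a.
exists q => //; split => // r sr rq.
have rp x : Z x -> r x <= p x by move=> Zx; apply: le_trans (rq x Zx) (qp x Zx).
have := qmin (exist _ r (conj sr rp)).
by move=> /(_ (introT (asboolP _) rq)) /asboolP.
Qed.

Lemma minimal_sublinear_linear p : minimal_sublinear_on Z p -> linear_on Z p.
Proof.
move=> [sp pmin].
have pD x y : Z x -> Z y -> p (x + y) = p x + p y.
  move=> Zx Zy; apply/eqP; rewrite eq_le (sp.1 _ _ Zx Zy)/=.
  pose ray : set (V * R^o) :=
    [set t *: ((y, p y) : V * R^o) | t in [set t | 0 <= t]].
  have below_ray : cone_below p ray.
    split.
    - by exists 0; rewrite /= ?scale0r.
    - move=> _ _ [s s_ge0 <-] [t t_ge0 <-].
      by exists (s + t); [exact: addr_ge0|rewrite scalerDl].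
    - move=> a _ a_ge0 [s s_ge0 <-].
      by exists (a * s); [exact: mulr_ge0|rewrite scalerA].
    - by move=> _ [t _ <-] /=; split; [exact: ZZ|exact: sublinear_onZ_ge].
  have ray_y : ray (y, p y) by exists 1; rewrite /= ?scale1r.
  rewrite -lerBrDr; apply: le_trans (cone_inf_le sp below_ray Zx ray_y).
  apply: pmin => //; first exact: cone_inf_sublinear.
  by move=> z Zz; exact: cone_inf_le_self.
have pN x : Z x -> p (- x) = - p x.
  move=> Zx; have := pD _ _ Zx (ZN Zx).
  by rewrite subrr (sublinear_on0 sp); lra.
split => // a x Zx; apply/eqP; rewrite eq_le sublinear_onZ_ge// andbT.
have := sublinear_onZ_ge a sp (ZN Zx).
by rewrite scalerN !pN// ?mulrN ?lerN2//; exact: ZZ.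
Qed.

Theorem mazur_orlicz p D : sublinear_on Z p -> cone_below p D ->
  exists F, [/\ linear_on Z F, forall x, Z x -> F x <= p x &
    forall u, D u -> u.2 <= F u.1].
Proof.
move=> sp Dp.
have [F Fmin Finf] := exists_minimal_sublinear (cone_inf_sublinear sp Dp).
have linF := minimal_sublinear_linear Fmin; exists F; split => // [x Zx|u Du].
  exact: le_trans (Finf _ Zx) (cone_inf_le_self sp Dp Zx).
have [_ _ _ /(_ u Du)[Zu _]] := Dp.
have := le_trans (Finf _ (ZN Zu)) (cone_inf_le sp Dp (ZN Zu) Du).
by rewrite addNr (sublinear_on0 sp) -scaleN1r linF.2// mulN1r sub0r lerN2.
Qed.

Corollary mazur_orlicz_interpolation (I : Type) (x : I -> V) (t : I -> R) p :
  sublinear_on Z p -> (forall i, Z (x i)) ->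
  (forall s : seq (R * I), \sum_(k <- s) k.1 * t k.2 <=
    p (\sum_(k <- s) k.1 *: x k.2)) ->
  exists F, [/\ linear_on Z F, forall z, Z z -> F z <= p z &
    forall i, F (x i) = t i].
Proof.
move=> sp Zx tp.
pose comb (s : seq (R * I)) : V * R^o :=
  (\sum_(k <- s) k.1 *: x k.2, \sum_(k <- s) k.1 * t k.2).
have below_comb : cone_below p (range comb).
  split.
  - by exists [::]; rewrite /comb ?big_nil.
  - by move=> _ _ [s _ <-] [s' _ <-]; exists (s ++ s'); rewrite /comb ?big_cat.
  - move=> a _ _ [s _ <-]; exists [seq (a * k.1, k.2) | k <- s] => //.
    rewrite /comb !big_map; congr pair; rewrite /= scaler_sumr.
      by apply: eq_bigr => k _; rewrite scalerA.
    by apply: eq_bigr => k _; rewrite -mulrA.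
  - move=> _ [s _ <-]; split; last exact: tp.
    by apply: linear_subspace_sum => // k; exact: ZZ.
have [F [linF Fp Fcomb]] := mazur_orlicz sp below_comb.
exists F; split => // i.
have Fge a : a * t i <= a * F (x i).
  have := Fcomb (comb [:: (a, i)]); rewrite /comb !big_seq1 /= linF.2//.
  by apply; exists [:: (a, i)]; rewrite //= !big_seq1.
by have := Fge 1; have := Fge (-1); lra.
Qed.

Corollary supporting_functional p x : sublinear_on Z p -> Z x ->
  exists F, [/\ linear_on Z F, forall z, Z z -> F z <= p z & F x = p x].
Proof.
move=> sp Zx.
have [_|s|F [linF Fp Fx]] :=
  @mazur_orlicz_interpolation unit (fun=> x) (fun=> p x) p sp.
- exact: Zx.
- by rewrite -mulr_suml -scaler_suml; exact: sublinear_onZ_ge.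
- by exists F; split => //; exact: (Fx tt).
Qed.

End MazurOrlicz.

Lemma linear_on_funD {R : realType} {T : Type} (Z : set (T -> R))
    (F : (T -> R) -> R) f g :
  linear_on Z F -> Z f -> Z g -> F (fun x => f x + g x) = F f + F g.
Proof. by move=> [FD _]; exact: FD. Qed.

Lemma linear_on_funZ {R : realType} {T : Type} (Z : set (T -> R))
    (F : (T -> R) -> R) a f :
  linear_on Z F -> Z f -> F (fun x => a * f x) = a * F f.
Proof. by move=> [_ FZ]; exact: FZ. Qed.

Lemma linear_subspace_funD {R : realType} {T : Type} (Z : set (T -> R)) f g :
  linear_subspace Z -> Z f -> Z g -> Z (fun x => f x + g x).
Proof. by move=> [_ ZD _]; exact: ZD. Qed.

Lemma linear_subspace_funZ {R : realType} {T : Type} (Z : set (T -> R)) a f :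
  linear_subspace Z -> Z f -> Z (fun x => a * f x).
Proof. by move=> [_ _ ZZ]; exact: ZZ. Qed.

(** * Ideal spaces *)

Section SolidSpaces.
Context {d : measure_display} {T : measurableType d} {R : realType}.
Variable mu : {measure set T -> \bar R}.
Implicit Types (mem : (T -> R) -> Prop) (nrm : (T -> R) -> \bar R).

Record solid_space mem nrm : Prop := SolidSpace {
  solid_measurable : forall f, mem f -> measurable_fun setT f;
  solid_subspace : linear_subspace mem;
  solid_fin_num : forall f, mem f -> nrm f \is a fin_num;
  solid_norm_ge0 : forall f, mem f -> (0 <= nrm f)%E;
  solid_normD : forall f g, mem f -> mem g ->
    (nrm (fun x => (f x + g x)%R) <= nrm f + nrm g)%E;
  solid_normZ_le : forall (a : R) f, mem f ->
    (nrm (fun x => (a * f x)%R) <= `|a|%:E * nrm f)%E;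
  solid_le : forall f g : T -> R, measurable_fun setT f -> mem g ->
    {ae mu, forall x, `|f x| <= `|g x|} -> mem f /\ (nrm f <= nrm g)%E }.

(* Completeness is only ever used in this form, which Koethe duals inherit
   directly. *)
Definition norm_dominated mem nrm := forall u : nat -> T -> R,
  (forall n, mem (u n)) -> (forall n, (nrm (u n) <= (2^-1 ^+ n)%:E)%E) ->
  exists2 F, mem F & forall n, {ae mu, forall x, `|u n x| <= F x}.

Record ideal_space mem nrm : Prop := IdealSpace {
  ideal_solid :> solid_space mem nrm;
  ideal_dominated : norm_dominated mem nrm }.

Lemma measurable_fun_normr (f : T -> R) :
  measurable_fun setT f -> measurable_fun setT (fun x => `|f x|).
Proof. by move=> mf; exact: measurableT_comp. Qed.

Section SolidSpaceTheory.
Variables (mem : (T -> R) -> Prop) (nrm : (T -> R) -> \bar R).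
Hypothesis solid : solid_space mem nrm.

Lemma solid_mem0 : mem (fun=> 0).
Proof. by case: (solid_subspace solid). Qed.

Lemma solid_memD f g : mem f -> mem g -> mem (fun x => f x + g x).
Proof. exact: linear_subspace_funD (solid_subspace solid). Qed.

Lemma solid_memZ a f : mem f -> mem (fun x => a * f x).
Proof. exact: linear_subspace_funZ (solid_subspace solid). Qed.

Lemma solid_memB f g : mem f -> mem g -> mem (fun x => f x - g x).
Proof.
move=> Mf Mg; under eq_fun do rewrite -mulN1r.
by apply: solid_memD => //; exact: solid_memZ.
Qed.

Lemma solid_mem_sum (I : Type) (s : seq I) (F : I -> T -> R) :
  (forall i, mem (F i)) -> mem (fun x => \sum_(i <- s) F i x).
Proof.
move=> MF; rewrite -fct_sumE.
exact: linear_subspace_sum (solid_subspace solid) MF.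
Qed.

Lemma solid_mem_lincomb n (a : nat -> R) (f : nat -> T -> R) :
  (forall k, mem (f k)) -> mem (fun x => \sum_(k < n) a k * f k x).
Proof.
move=> Mf.
have Maf (k : 'I_n) : mem (fun x => a k * f k x) by exact: solid_memZ.
exact: solid_mem_sum.
Qed.

Lemma solid_mem_le (f g : T -> R) : measurable_fun setT f -> mem g ->
  (forall x, `|f x| <= `|g x|) -> mem f.
Proof. by move=> mf Mg fg; apply: (solid_le solid mf Mg _).1; exact: aeW. Qed.

Lemma solid_norm_le (f g : T -> R) : measurable_fun setT f -> mem g ->
  (forall x, `|f x| <= `|g x|) -> (nrm f <= nrm g)%E.
Proof. by move=> mf Mg fg; apply: (solid_le solid mf Mg _).2; exact: aeW. Qed.

Lemma solid_mem_normr f : mem f -> mem (fun x => `|f x|).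
Proof.
move=> Mf; apply: (solid_mem_le _ Mf); last by move=> x; rewrite normr_id.
exact/measurable_fun_normr/(solid_measurable solid).
Qed.

Lemma solid_norm_normr f : mem f -> nrm (fun x => `|f x|) = nrm f.
Proof.
move=> Mf; have mf := solid_measurable solid Mf; apply/eqP; rewrite eq_le.
have Mabsf := solid_mem_normr Mf; have mabsf := solid_measurable solid Mabsf.
by rewrite !solid_norm_le// => x; rewrite normr_id.
Qed.

Lemma solid_mem_mul_le1 (w f : T -> R) : measurable_fun setT w ->
  (forall x, `|w x| <= 1) -> mem f -> mem (fun x => w x * f x).
Proof.
move=> mw w1 Mf; apply: (solid_mem_le _ Mf).
  by apply: measurable_funM => //; exact: (solid_measurable solid).
by move=> x; rewrite normrM ler_piMl.
Qed.

Lemma solid_norm_mul_le1 (w f : T -> R) : measurable_fun setT w ->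
  (forall x, `|w x| <= 1) -> mem f -> (nrm (fun x => (w x * f x)%R) <= nrm f)%E.
Proof.
move=> mw w1 Mf; apply: (solid_norm_le _ Mf).
  by apply: measurable_funM => //; exact: (solid_measurable solid).
by move=> x; rewrite normrM ler_piMl.
Qed.

Lemma solid_normZ a f : mem f ->
  nrm (fun x => a * f x) = (`|a|%:E * nrm f)%E.
Proof.
move=> Mf; apply/eqP; rewrite eq_le (solid_normZ_le solid)//=.
have [->|a0] := eqVneq a 0.
  by rewrite normr0 mul0e (solid_norm_ge0 solid)//; exact: solid_memZ.
have := solid_normZ_le solid a^-1 (solid_memZ a Mf).
under eq_fun do rewrite mulKf//.
by rewrite normfV lee_pdivlMl ?normr_gt0.
Qed.

Lemma solid_norm0 : nrm (fun=> 0) = 0%E.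
Proof.
have := solid_normZ 0 solid_mem0; rewrite normr0 mul0e => <-.
by under [in RHS]eq_fun do rewrite mulr0.
Qed.

Lemma solid_norm_distC f g : mem f -> mem g ->
  nrm (fun x => f x - g x) = nrm (fun x => g x - f x).
Proof.
move=> Mf Mg; have Mgf := solid_memB Mg Mf.
rewrite -[RHS]mul1e -(normrN1 R) -solid_normZ//.
by under [in RHS]eq_fun do rewrite mulN1r opprB.
Qed.

Lemma fine_solid_norm_ge0 f : mem f -> 0 <= fine (nrm f).
Proof. by move=> Mf; rewrite fine_ge0// (solid_norm_ge0 solid). Qed.

Lemma le_fine_solid_norm f a : mem f -> (fine (nrm f) <= a) = (nrm f <= a%:E)%E.
Proof. by move=> Mf; rewrite -lee_fin fineK// (solid_fin_num solid). Qed.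

Lemma solid_norm_sublinear (C : R) : 0 <= C ->
  sublinear_on mem (fun f => C * fine (nrm f)).
Proof.
move=> C_ge0; split=> [f g Mf Mg|a f a_ge0 Mf].
  rewrite -mulrDr ler_wpM2l// le_fine_solid_norm; last exact: solid_memD.
  by rewrite EFinD !fineK ?(solid_fin_num solid)//; exact: (solid_normD solid).
rewrite mulrCA ler_wpM2l// le_fine_solid_norm; last exact: solid_memZ.
by rewrite EFinM fineK ?(solid_fin_num solid)// solid_normZ// ger0_norm.
Qed.

End SolidSpaceTheory.
End SolidSpaces.

Lemma halfX_gt0 {R : realType} n : 0 < (2^-1 : R) ^+ n.
Proof. by rewrite exprn_gt0// invr_gt0. Qed.

Lemma cvg_halfX {R : realType} : (fun n => (2^-1 : R) ^+ n) @ \oo --> (0 : R).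
Proof. by apply: cvg_expr; rewrite ger0_norm; lra. Qed.

Section BanachFunctionSpaces.
Context {d : measure_display} {T : measurableType d} {R : realType}.
Variables (mu : {measure set T -> \bar R}) (X : BFS mu).

Lemma bfs_solid_space : solid_space mu (bfs_mem X) (bfs_enorm X).
Proof.
split.
- exact: bfs_meas.
- by split; [exact: bfs_mem0|exact: bfs_memD|exact: bfs_memZ].
- by [].
- by move=> f Xf; rewrite lee_fin bfs_norm_ge0.
- by move=> f g Xf Xg; rewrite -EFinD lee_fin bfs_normD.
- by move=> a f Xf; rewrite /bfs_enorm bfs_normZ.
- by move=> f g mf Xg fg; rewrite lee_fin; exact: bfs_ideal.
Qed.

Let solidX := bfs_solid_space.

Let absum (u : nat -> T -> R) N x := \sum_(k < N) `|u k x|.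

Let absum_mem u N : (forall n, bfs_mem X (u n)) -> bfs_mem X (absum u N).
Proof.
move=> Xu; have Xabsu (k : 'I_N) : bfs_mem X (fun x => `|u k x|).
  exact: (solid_mem_normr solidX).
exact: (solid_mem_sum solidX).
Qed.

Let absum_norm_dist u N k : (forall n, bfs_mem X (u n)) ->
  (forall n, bfs_norm X (u n) <= 2^-1 ^+ n) ->
  bfs_norm X (fun x => absum u (N + k) x - absum u N x) <=
    2 * 2^-1 ^+ N - 2 * 2^-1 ^+ (N + k).
Proof.
move=> Xu uh; elim: k => [|k IH].
  rewrite addn0 subrr; under eq_fun do rewrite subrr.
  by rewrite (bfs_norm_eq0 (bfs_mem0 X)).2//; exact: aeW.
rewrite addnS (_ : (fun x => _) = fun x =>
  (absum u (N + k) x - absum u N x) + `|u (N + k)%N x|); last first.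
  by apply/funext => x; rewrite /absum big_ord_recr/= addrAC.
have := bfs_normD (solid_memB solidX (absum_mem (N + k) Xu) (absum_mem N Xu))
  (solid_mem_normr solidX (Xu (N + k)%N)).
have [->] := solid_norm_normr solidX (Xu (N + k)%N).
by have := uh (N + k)%N; rewrite exprS; lra.
Qed.

Lemma bfs_absum_cvg u : (forall n, bfs_mem X (u n)) ->
  (forall n, bfs_norm X (u n) <= 2^-1 ^+ n) ->
  exists2 F, bfs_mem X F &
    (fun n => bfs_norm X (fun x => \sum_(k < n) `|u k x| - F x)) @ \oo --> 0.
Proof.
move=> Xu uh; suff [F [XF uF]] : exists F, bfs_mem X F /\
    (fun n => bfs_norm X (fun x => absum u n x - F x)) @ \oo --> 0 by exists F.
apply: bfs_complete => [n|e e_gt0]; first exact: absum_mem.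
have e2_gt0 : 0 < e / 2 by lra.
have /cvgr0Pnorm_lt /(_ _ e2_gt0)[N _ /(_ N (leqnn N))/= Ne] := @cvg_halfX R.
rewrite gtr0_norm ?halfX_gt0// in Ne.
exists N => m n Nm Nn; wlog mn : m n Nm Nn / (n <= m)%N.
  move=> wlog_le; have [mn|/ltnW nm] := leqP n m; first exact: wlog_le.
  have [->] := solid_norm_distC solidX (absum_mem m Xu) (absum_mem n Xu).
  exact: wlog_le.
rewrite -(subnKC mn); apply: le_lt_trans (absum_norm_dist _ _ Xu uh) _.
have : (2^-1 : R) ^+ n <= 2^-1 ^+ N by rewrite ler_wiXn2l//; lra.
have := @halfX_gt0 R (n + (m - n)); lra.
Qed.

Lemma bfs_nondecreasing_le_lim (s : nat -> T -> R) F :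
  (forall n, bfs_mem X (s n)) -> bfs_mem X F ->
  (forall x, nondecreasing_seq (s ^~ x)) ->
  (fun n => bfs_norm X (fun x => s n x - F x)) @ \oo --> 0 ->
  forall n, {ae mu, forall x, s n x <= F x}.
Proof.
move=> Xs XF s_nd sF n; pose excess x := Num.max (s n x - F x) 0.
have mexcess : measurable_fun setT excess.
  apply: measurable_maxr => //; apply: measurable_funB.
    exact: bfs_meas (Xs n).
  exact: bfs_meas XF.
have excess_le m : (n <= m)%N -> bfs_mem X excess /\
    bfs_norm X excess <= bfs_norm X (fun x => s m x - F x).
  move=> nm; apply: bfs_ideal => //; first exact: (solid_memB solidX).
  apply: aeW => x; have snm := s_nd x _ _ nm.
  rewrite ger0_norm ?le_max ?lexx ?orbT// ge_max normr_ge0 andbT.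
  by apply: le_trans (ler_norm _); rewrite lerD2r.
have [Xexcess _] := excess_le n (leqnn n).
have : bfs_norm X excess = 0.
  apply/eqP; rewrite eq_le bfs_norm_ge0// andbT.
  apply: (cvgr_to_ge sF).
  by exists n => // m /= /excess_le [].
move/(bfs_norm_eq0 Xexcess); apply: filterS => x ex0.
by rewrite -subr_le0 -ex0 le_max lexx.
Qed.

Lemma bfs_ideal_space : ideal_space mu (bfs_mem X) (bfs_enorm X).
Proof.
split; first exact: bfs_solid_space.
move=> u Xu uh; have [F XF uF] := bfs_absum_cvg Xu (fun n => uh n).
exists F => // n.
have s_nd x : nondecreasing_seq (fun N => \sum_(k < N) `|u k x|).
  by apply/nondecreasing_seqP => N; rewrite /= big_ord_recr lerDl.
have := bfs_nondecreasing_le_lim (fun N => absum_mem N Xu) XF s_nd uF n.+1.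
apply: filterS => x; apply: le_trans; rewrite /absum big_ord_recr/= lerDr.
by apply: sumr_ge0.
Qed.

End BanachFunctionSpaces.

Section IdealSpaceTheory.
Context {d : measure_display} {T : measurableType d} {R : realType}.
Variable mu : {measure set T -> \bar R}.
Variables (mem : (T -> R) -> Prop) (nrm : (T -> R) -> \bar R).
Hypothesis ideal : ideal_space mu mem nrm.

Lemma ideal_dominated_scaled (u : nat -> T -> R) : (forall n, mem (u n)) ->
  exists2 F, mem F &
    forall n, exists2 c, 0 < c & {ae mu, forall x, c * `|u n x| <= F x}.
Proof.
move=> Mu; pose c n := 2^-1 ^+ n / (1 + fine (nrm (u n))).
have norm1_gt0 n : 0 < 1 + fine (nrm (u n)).
  by rewrite ltr_pwDl// (fine_solid_norm_ge0 ideal).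
have c_gt0 n : 0 < c n by rewrite divr_gt0 ?halfX_gt0.
have [n|n|F MF Fu] := ideal_dominated ideal (u := fun n x => c n * u n x).
- exact: (solid_memZ ideal).
- rewrite (solid_normZ ideal)// -(fineK (solid_fin_num ideal (Mu n))) -EFinM.
  rewrite lee_fin gtr0_norm// /c mulrAC ler_pdivrMr//.
  by rewrite ler_pM2l ?halfX_gt0// lerDr.
exists F => // n; exists (c n) => //; apply: filterS (Fu n) => x.
by rewrite normrM gtr0_norm.
Qed.

(* Gliding hump: if Phi were unbounded, then Phi (v n) = 2 ^+ n for suitable v n
   with nrm (v n) <= 2 ^- n, and these are dominated by a single function. *)
Lemma ideal_functional_bounded (Phi : (T -> R) -> \bar R) :
  (forall f, mem f -> Phi f \is a fin_num) ->
  (forall f g, mem f -> mem g -> {ae mu, forall x, `|f x| <= `|g x|} ->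
    (Phi f <= Phi g)%E) ->
  (forall a f, mem f -> Phi (fun x => a * f x) = (`|a|%:E * Phi f)%E) ->
  exists2 K : R, 0 < K & forall f, mem f -> (Phi f <= K%:E * nrm f)%E.
Proof.
move=> Phi_fin Phi_le PhiZ; apply: contrapT => /forall2NP unbounded.
have /choice[f fP] n : exists f, mem f /\ ((4 ^+ n)%:E * nrm f < Phi f)%E.
  have [|/existsNP[f /not_implyP[Mf /negP Phif]]] := unbounded (4 ^+ n).
    by case; rewrite exprn_gt0.
  by exists f; split => //; rewrite ltNge.
have Mf n : mem (f n) := (fP n).1.
have PhiE n : Phi (f n) = (fine (Phi (f n)))%:E by rewrite fineK// Phi_fin.
have normE n : nrm (f n) = (fine (nrm (f n)))%:E.
  by rewrite fineK// (solid_fin_num ideal).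
have norm_lt n : 4 ^+ n * fine (nrm (f n)) < fine (Phi (f n)).
  by rewrite -lte_fin EFinM -PhiE -normE; exact: (fP n).2.
have Phi_gt0 n : 0 < fine (Phi (f n)).
  apply: le_lt_trans (norm_lt n); rewrite mulr_ge0 ?exprn_ge0//.
  exact: (fine_solid_norm_ge0 ideal).
pose c n : R := 2 ^+ n / fine (Phi (f n)).
have c_gt0 n : 0 < c n by rewrite divr_gt0// exprn_gt0.
have [n|n|F MF Fv] := ideal_dominated ideal (u := fun n x => c n * f n x).
- exact: (solid_memZ ideal).
- rewrite (solid_normZ ideal)// normE -EFinM lee_fin gtr0_norm//.
  rewrite /c mulrAC ler_pdivrMr// exprVn mulrC.
  rewrite -ler_pdivrMl ?invr_gt0 ?exprn_gt0// invrK.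
  by rewrite mulrCA -exprMn (_ : 2 * 2 = 4) 1?mulrC ?ltW// -natrM.
pose m := (Num.truncn (fine (Phi F))).+1.
have : fine (Phi F) < 2 ^+ m.
  apply: lt_trans (truncnS_gt _) _.
  by rewrite -natrX ltr_nat ltn_expl.
apply/negP; rewrite -leNgt -lee_fin fineK ?Phi_fin//.
have <- : Phi (fun x => c m * f m x) = (2 ^+ m)%:E.
  by rewrite PhiZ// PhiE -EFinM gtr0_norm// /c divfK// gt_eqF.
apply: Phi_le => //; first exact: (solid_memZ ideal).
by apply: filterS (Fv m) => x /le_trans; apply; exact: ler_norm.
Qed.

Lemma ideal_cvg0_ae (u : nat -> T -> R) (c : R) : 0 < c ->
  (forall n, mem (u n)) -> (forall n, (nrm (u n) <= (c * 4^-1 ^+ n)%:E)%E) ->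
  {ae mu, forall x, (fun n => u n x) @ \oo --> (0 : R)}.
Proof.
move=> c_gt0 Mu unorm.
have scale_gt0 n : 0 < 2 ^+ n / c by rewrite divr_gt0// exprn_gt0.
have [n|n|F MF Fu] :=
  ideal_dominated ideal (u := fun n x => 2 ^+ n / c * u n x).
- exact: (solid_memZ ideal).
- rewrite (solid_normZ ideal)// gtr0_norm//.
  apply: le_trans (lee_wpmul2l _ (unorm n)) _; first by rewrite lee_fin ltW.
  rewrite -EFinM lee_fin mulrA divfK ?gt_eqF// -exprMn.
  by rewrite (_ : 2 / 4 = 2^-1)//; lra.
have {Fu} := ae_foralln Fu; apply: filterS => x Fx.
have ux n : `|u n x| <= (F x * c) * 2^-1 ^+ n.
  have := Fx n; rewrite normrM gtr0_norm//.
  by rewrite mulrAC ler_pdivrMr// exprVn ler_pdivlMr ?exprn_gt0// mulrC.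
have cvF : (fun n => (F x * c) * 2^-1 ^+ n) @ \oo --> (0 : R).
  by rewrite -(mulr0 (F x * c)); apply: cvgMl_tmp; exact: cvg_halfX.
apply: norm_cvg0; apply: (squeeze_cvgr _ (cvg_cst 0) cvF).
by apply: nearW => n; rewrite normr_ge0/=.
Qed.

End IdealSpaceTheory.

Section WeakUnit.
Context {d : measure_display} {T : measurableType d} {R : realType}.
Variable mu : {measure set T -> \bar R}.

Lemma le_measure_ae (A B : set T) : measurable A -> measurable B ->
  {ae mu, forall x, A x -> B x} -> (mu A <= mu B)%E.
Proof.
move=> mA mB [N [mN N0 AB]].
rewrite -(adde0 (mu B)) -N0; apply: le_trans (measureU2 _ mB mN).
apply: le_measure; rewrite ?inE//; first exact: measurableU.
move=> x Ax; have [Bx|Bx] := pselect (B x); first by left.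
by right; apply: AB => /= /(_ Ax).
Qed.

Lemma measurable_zeros (f : T -> R) : measurable_fun setT f ->
  measurable [set x | f x = 0].
Proof.
by move=> mf; rewrite -[X in measurable X]setTI; exact: (mf _ [set 0]).
Qed.

Lemma exists_minimal_measure (E : set (set T)) : E !=set0 ->
  (forall A, E A -> measurable A /\ (mu A < +oo)%E) ->
  (forall A : nat -> set T, (forall n, E (A n)) ->
    exists2 B, E B & forall n, {ae mu, forall x, B x -> A n x}) ->
  exists2 B, E B & forall A, E A -> (mu B <= mu A)%E.
Proof.
move=> [A0 EA0] Emeas Einf; pose masses := [set fine (mu A) | A in E].
have fin A : E A -> mu A \is a fin_num.
  by move=> /Emeas[_ ?]; rewrite ge0_fin_numE.
have inf_masses : has_inf masses.
  split; first by exists (fine (mu A0)), A0.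
  by exists 0 => _ [A _ <-]; rewrite fine_ge0.
have /choice[A AP] n : exists A, E A /\ fine (mu A) < inf masses + 2^-1 ^+ n.
  by have [_ [A EA <-] A_lt] := inf_adherent (halfX_gt0 n) inf_masses; exists A.
have [B EB BA] := Einf A (fun n => (AP n).1).
exists B => // A' EA'; apply: (@le_trans _ _ (inf masses)%:E); last first.
  rewrite -[mu A']fineK ?fin// lee_fin.
  by apply: ge_inf; [case: inf_masses|exists A'].
rewrite -[mu B]fineK ?fin// lee_fin -[leRHS]addr0.
apply: (cvgr_to_ge (cvgD (cvg_cst (inf masses)) cvg_halfX)).
apply: nearW => n; apply: le_trans (ltW (AP n).2).
have [[mA _] [mB _]] := (Emeas _ (AP n).1, Emeas _ EB).
by apply: fine_le; [exact: fin|exact: fin (AP n).1|exact: le_measure_ae].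
Qed.

Variables (mem : (T -> R) -> Prop) (nrm : (T -> R) -> \bar R).
Hypotheses (ideal : ideal_space mu mem nrm) (sat : saturated mu mem).

(* A zero set of minimal measure is null: adding any member of the space to the
   minimizer cannot shrink its zero set further. *)
Lemma saturated_finite_carrier (D : set T) : measurable D -> (mu D < +oo)%E ->
  exists2 f, mem f & mu (D `&` [set x | f x = 0]) = 0%E.
Proof.
move=> mD Dfin; pose Dzeros (f : T -> R) := D `&` [set x | f x = 0].
have mDzeros f : mem f -> measurable (Dzeros f).
  move=> Mf; apply/measurableI/measurable_zeros => //.
  exact: (solid_measurable ideal).
have [|_ [f Mf <-]|A EA|_ [F MF <-] Fmin] :=
  @exists_minimal_measure [set Dzeros f | f in mem].
- by exists (Dzeros (fun=> 0)), (fun=> 0) => //; exact: (solid_mem0 ideal).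
- split; first exact: mDzeros.
  apply: le_lt_trans Dfin; apply: le_measure; rewrite ?inE//.
    exact: mDzeros.
  exact: subIsetl.
- have /choice[f fP] n : exists f, mem f /\ Dzeros f = A n.
    by have [f Mf <-] := EA n; exists f.
  have [F MF Ff] := ideal_dominated_scaled ideal (fun n => (fP n).1).
  exists (Dzeros F) => [|n]; first by exists F.
  have [c c_gt0] := Ff n; apply: filterS => x Fx [Dx /= F0].
  rewrite -(fP n).2; split => //=; apply/eqP; rewrite -normr_le0.
  by rewrite -(pmulr_rle0 _ c_gt0) -F0.
exists F => //; apply: contrapT => mass0; apply: sat; exists (Dzeros F); split.
- exact: mDzeros.
- by rewrite lt0e measure_ge0 andbT; exact/eqP.
move=> g Mg; have mg := measurable_zeros (solid_measurable ideal Mg).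
have mF := mDzeros _ MF.
have Ffin : (mu (Dzeros F) < +oo)%E.
  apply: le_lt_trans Dfin; apply: le_measure; rewrite ?inE//.
  exact: subIsetl.
have min_g : mu (Dzeros F `&` [set x | g x = 0]) = mu (Dzeros F).
  apply/eqP; rewrite eq_le measureIl//=.
  have -> : Dzeros F `&` [set x | g x = 0] = Dzeros (fun x => `|F x| + `|g x|).
    apply/seteqP; split => x.
      by move=> [[Dx /= Fx] /= gx]; split; rewrite //= Fx gx normr0 addr0.
    by move=> [Dx /eqP]; rewrite paddr_eq0// !normr_eq0 => /andP[/eqP ? /eqP ?].
  apply: Fmin; exists (fun x => `|F x| + `|g x|) => //.
  by apply: (solid_memD ideal); exact: (solid_mem_normr ideal).
exists (Dzeros F `\` [set x | g x = 0]); split; first exact: measurableD.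
- by rewrite measureD// [X in (_ - X)%E]min_g subee// ge0_fin_numE.
- by move=> x /= /not_implyP[].
Qed.

Lemma weak_unit : sigma_finite setT mu -> exists2 e, mem e & forall x, 0 < e x.
Proof.
move=> [D DT mD].
have /choice[f fP] n : exists f, mem f /\ mu (D n `&` [set x | f x = 0]) = 0%E.
  have [mDn Dn] := mD n; have [f ? ?] := saturated_finite_carrier mDn Dn.
  by exists f.
have [e Me ef] := ideal_dominated_scaled ideal (fun n => (fP n).1).
have ae_e : {ae mu, forall x, 0 < e x}.
  have : {ae mu, forall x, forall n, D n x -> 0 < e x}.
    apply: ae_foralln => n; have [c c_gt0 ce] := ef n.
    have : {ae mu, forall x, D n x -> f n x != 0}.
      exists (D n `&` [set x | f n x = 0]); split.
      - apply: measurableI; first exact: (mD n).1.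
        exact/measurable_zeros/(solid_measurable ideal)/(fP n).1.
      - exact: (fP n).2.
      - by move=> x /= /not_implyP[Dx /negP]; rewrite negbK => /eqP.
    apply: filterS2 ce => x ex fx Dx; apply: lt_le_trans ex.
    by rewrite mulr_gt0// normr_gt0 fx.
  apply: filterS => x De; have : (\bigcup_n D n) x by rewrite -DT.
  by move=> [n _ /De].
exists (fun x => if 0 < e x then e x else 1) => [|x]; last by case: ifPn.
have me := solid_measurable ideal Me.
apply: (solid_le ideal _ Me _).1.
  by apply: measurable_fun_ifT => //; exact: measurable_fun_ltr.
by apply: filterS ae_e => x ->.
Qed.

End WeakUnit.

(** * Integrable functions and Koethe duals *)

Section L1.
Context {d : measure_display} {T : measurableType d} {R : realType}.
Variable mu : {measure set T -> \bar R}.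
Implicit Types (f g : T -> R) (u : nat -> T -> R).

Definition L1_norm f : \bar R := (\int[mu]_x (`|f x|)%:E)%E.

Lemma L1_memP f : L1_mem mu f <->
  measurable_fun setT f /\ (L1_norm f < +oo)%E.
Proof.
split=> [/integrableP[mf f_fin]|[mf f_fin]].
  by split; first exact/measurable_EFinP.
by apply/integrableP; split; first exact/measurable_EFinP.
Qed.

Lemma L1_mem_measurable f : L1_mem mu f -> measurable_fun setT f.
Proof. by case/L1_memP. Qed.

Lemma measurable_EFin_normr f : measurable_fun setT f ->
  measurable_fun setT (fun x => (`|f x|)%:E).
Proof. by move=> mf; exact/measurable_EFinP/measurable_fun_normr. Qed.

Lemma L1_norm_ge0 f : (0 <= L1_norm f)%E.
Proof. exact: integral_ge0. Qed.

Lemma le_L1_norm f g : measurable_fun setT f -> measurable_fun setT g ->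
  {ae mu, forall x, `|f x| <= `|g x|} -> (L1_norm f <= L1_norm g)%E.
Proof.
move=> mf mg fg.
apply: ae_ge0_le_integral => //; try exact: measurable_EFin_normr.
by apply: filterS fg => x + _; rewrite lee_fin.
Qed.

Lemma L1_normZ a f : measurable_fun setT f ->
  L1_norm (fun x => a * f x) = (`|a|%:E * L1_norm f)%E.
Proof.
move=> mf; rewrite /L1_norm; under eq_integral do rewrite normrM EFinM.
by rewrite ge0_integralZl_EFin//; exact: measurable_EFin_normr.
Qed.

Lemma L1_normD f g : measurable_fun setT f -> measurable_fun setT g ->
  (L1_norm (fun x => (f x + g x)%R) <= L1_norm f + L1_norm g)%E.
Proof.
move=> mf mg; rewrite -ge0_integralD//; try exact: measurable_EFin_normr.
apply: ge0_le_integral => //.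
- by apply: measurable_EFin_normr; exact: measurable_funD.
- by apply: emeasurable_funD; exact: measurable_EFin_normr.
- by move=> x _; rewrite -EFinD lee_fin ler_normD.
Qed.

Lemma EFin_Rintegral f : L1_mem mu f ->
  (\int[mu]_x f x)%R%:E = (\int[mu]_x (f x)%:E)%E.
Proof. by move=> Lf; rewrite fineK//; exact: integrable_fin_num. Qed.

Lemma normr_Rintegral_le_L1_norm f : L1_mem mu f ->
  (`|\int[mu]_x f x|%:E <= L1_norm f)%E.
Proof.
move=> Lf; rewrite EFin_normr_Rintegral//.
by apply: le_abse_integral => //; exact: measurable_int Lf.
Qed.

Lemma Rintegral_le_L1_norm f : L1_mem mu f ->
  ((\int[mu]_x f x)%R%:E <= L1_norm f)%E.
Proof.
move=> Lf; apply: le_trans (normr_Rintegral_le_L1_norm Lf).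
by rewrite lee_fin ler_norm.
Qed.

Lemma L1_solid_space : solid_space mu (L1_mem mu) L1_norm.
Proof.
split.
- exact: L1_mem_measurable.
- split; first exact: integrable0.
  + by move=> f g; exact: integrableD.
  + by move=> a f; exact: integrableZl.
- by move=> f /L1_memP[_]; rewrite ge0_fin_numE// L1_norm_ge0.
- by move=> f _; exact: L1_norm_ge0.
- by move=> f g Lf Lg; apply: L1_normD; exact: L1_mem_measurable.
- by move=> a f Lf; rewrite L1_normZ//; exact: L1_mem_measurable.
- move=> f g mf /L1_memP[mg gfin] fg; have fg_norm := le_L1_norm mf mg fg.
  by split=> //; apply/L1_memP; split => //; exact: le_lt_trans gfin.
Qed.

Lemma L1_mem_indic (A : set T) : measurable A -> (mu A < +oo)%E ->
  L1_mem mu (\1_A).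
Proof.
move=> mA Afin; apply/L1_memP; split; first exact: measurable_indic.
rewrite /L1_norm; under eq_integral do rewrite ger0_norm//.
by rewrite integral_indic// setIT.
Qed.

(* Junk value 0 at the points where the series diverges. *)
Definition abs_series u x := fine (\sum_(0 <= n <oo) (`|u n x|)%:E)%E.

Lemma abs_eseries_ge0 u x : (0 <= \sum_(0 <= n <oo) (`|u n x|)%:E)%E.
Proof. by apply: nneseries_ge0 => n _ _; rewrite lee_fin. Qed.

Lemma abs_series_ge0 u x : 0 <= abs_series u x.
Proof. by rewrite fine_ge0// abs_eseries_ge0. Qed.

Lemma measurable_abs_eseries u : (forall n, measurable_fun setT (u n)) ->
  measurable_fun setT (fun x => \sum_(0 <= n <oo) (`|u n x|)%:E)%E.
Proof.
move=> meas_u; apply: (@ge0_emeasurable_sum _ _ _ _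
  (fun n x => (`|u n x|)%:E) xpredT) => [n x _ _|n _]; first by rewrite lee_fin.
exact: measurable_EFin_normr.
Qed.

Lemma measurable_abs_series u : (forall n, measurable_fun setT (u n)) ->
  measurable_fun setT (abs_series u).
Proof.
move=> meas_u.
have := measurable_abs_eseries meas_u.
exact: measurableT_comp (fine_measurable measurableT).
Qed.

Lemma abs_seriesM u f x :
  abs_series (fun n x => u n x * f x) x = abs_series u x * `|f x|.
Proof.
rewrite /abs_series; under eq_eseriesr do rewrite normrM mulrC EFinM.
rewrite nneseriesZl; last by move=> n _; rewrite lee_fin.
have [->|fx0] := eqVneq (f x) 0; first by rewrite normr0 mul0e mulr0.
have := abs_eseries_ge0 u x; case: (\sum_(0 <= n <oo) _)%E => [r _|_|//].
  by rewrite /= mulrC.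
by rewrite gt0_muley ?lte_fin ?normr_gt0//= mul0r.
Qed.

Lemma integral_abs_eseries u : (forall n, measurable_fun setT (u n)) ->
  (\int[mu]_x \sum_(0 <= n <oo) (`|u n x|)%:E =
   \sum_(0 <= n <oo) L1_norm (u n))%E.
Proof.
move=> meas_u; rewrite integral_nneseries// => n; exact: measurable_EFin_normr.
Qed.

Lemma L1_norm_abs_series_le u : (forall n, measurable_fun setT (u n)) ->
  (L1_norm (abs_series u) <= \sum_(0 <= n <oo) L1_norm (u n))%E.
Proof.
move=> meas_u; rewrite -integral_abs_eseries//; apply: ge0_le_integral => //.
- exact/measurable_EFin_normr/measurable_abs_series.
- exact: measurable_abs_eseries.
- move=> x _; rewrite ger0_norm ?abs_series_ge0// /abs_series.
  have := abs_eseries_ge0 u x.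
  by case: (\sum_(0 <= n <oo) _)%E => [r _|_|//]; rewrite ?leey.
Qed.

Lemma le_abs_series_ae u : (forall n, measurable_fun setT (u n)) ->
  (\sum_(0 <= n <oo) L1_norm (u n) < +oo)%E ->
  forall n, {ae mu, forall x, `|u n x| <= abs_series u x}.
Proof.
move=> meas_u ufin n.
have : mu.-integrable setT (fun x => \sum_(0 <= n <oo) (`|u n x|)%:E)%E.
  apply/integrableP; split; first exact: measurable_abs_eseries.
  under eq_integral do rewrite gee0_abs ?abs_eseries_ge0//.
  by rewrite integral_abs_eseries.
move=> /(integrable_ae measurableT); apply: filterS => x /(_ Logic.I) xfin.
rewrite -lee_fin fineK//.
apply: le_trans (nneseries_lim_ge n.+1 _) => [|k _ _]; last by rewrite lee_fin.
by rewrite big_nat_recr//= leeDr// sume_ge0// => k _; rewrite lee_fin.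
Qed.

Lemma nneseries_le_half (a : nat -> \bar R) (c : R) : (forall n, 0 <= a n)%E ->
  (forall n, a n <= (c * 2^-1 ^+ n)%:E)%E ->
  (\sum_(0 <= n <oo) a n <= (2 * c)%:E)%E.
Proof.
move=> a_ge0 ac.
have := cvg_lim (@ereal_hausdorff R) (@cvg_geometric_eseries_half R (2 * c) 0).
rewrite expr0 divr1 => <-; apply: lee_nneseries => n _ //.
apply: le_trans (ac n) _; rewrite lee_fin addn1 natrX exprS invfM exprVn.
by rewrite mulrACA divff ?mul1r.
Qed.

Lemma L1_ideal_space : ideal_space mu (L1_mem mu) L1_norm.
Proof.
split; first exact: L1_solid_space.
move=> u Lu unorm; have meas_u n := L1_mem_measurable (Lu n).
have ufin : (\sum_(0 <= n <oo) L1_norm (u n) < +oo)%E.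
  apply: le_lt_trans (ltry (2 * 1)); apply: nneseries_le_half => n.
    exact: L1_norm_ge0.
  by rewrite mul1r.
exists (abs_series u); last exact: le_abs_series_ae.
apply/L1_memP; split; first exact: measurable_abs_series.
exact: le_lt_trans (L1_norm_abs_series_le meas_u) ufin.
Qed.

End L1.

Section Multipliers.
Context {d : measure_display} {T : measurableType d} {R : realType}.
Variable mu : {measure set T -> \bar R}.

Lemma mulsp_bounded mem1 nrm1 mem2 nrm2 (h : T -> R) :
  ideal_space mu mem1 nrm1 -> solid_space mu mem2 nrm2 ->
  mulsp_mem mem1 mem2 h -> exists2 K : R, 0 < K &
    forall f, mem1 f -> (nrm2 (fun x => (h x * f x)%R) <= K%:E * nrm1 f)%E.
Proof.
move=> ideal1 solid2 [mh h12].
apply: (ideal_functional_bounded ideal1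
  (Phi := fun f => nrm2 (fun x => h x * f x))).
- by move=> f Mf; apply: (solid_fin_num solid2); exact: h12.
- move=> f g Mf Mg fg; apply: (solid_le solid2 _ (h12 _ Mg) _).2.
    by apply: measurable_funM => //; exact: (solid_measurable ideal1).
  by apply: filterS fg => x fgx; rewrite !normrM ler_wpM2l.
- move=> a f Mf; rewrite -(solid_normZ solid2); last exact: h12.
  by under eq_fun do rewrite mulrCA.
Qed.

End Multipliers.

Section KoetheDual.
Context {d : measure_display} {T : measurableType d} {R : realType}.
Variable mu : {measure set T -> \bar R}.
Variables (mem : (T -> R) -> Prop) (nrm : (T -> R) -> \bar R).
Hypothesis ideal : ideal_space mu mem nrm.
Local Notation dual := (kdual_mem mu mem).
Local Notation dual_norm := (kdual_norm mu mem nrm).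
Implicit Types h k f : T -> R.

Lemma kdual_mem_measurable h : dual h -> measurable_fun setT h.
Proof. by case. Qed.

Let measurable_mul_mem h f : measurable_fun setT h -> mem f ->
  measurable_fun setT (fun x => h x * f x).
Proof.
by move=> mh Mf; apply: measurable_funM => //; exact: (solid_measurable ideal).
Qed.

Lemma le_kdual_norm h f : mem f -> (nrm f <= 1)%E ->
  (L1_norm mu (fun x => h x * f x)%R <= dual_norm h)%E.
Proof. by move=> Mf f1; apply: ereal_sup_ubound; exists f. Qed.

Lemma kdual_norm_le h c : (forall f, mem f -> (nrm f <= 1)%E ->
  (L1_norm mu (fun x => h x * f x)%R <= c)%E) -> (dual_norm h <= c)%E.
Proof. by move=> hc; apply: ge_ereal_sup => _ [f [Mf f1] <-]; exact: hc. Qed.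

Lemma kdual_norm_ge0 h : (0 <= dual_norm h)%E.
Proof.
have norm0_le1 : (nrm (fun=> 0%R) <= 1)%E by rewrite (solid_norm0 ideal).
apply: le_trans (le_kdual_norm h (solid_mem0 ideal) norm0_le1).
exact: L1_norm_ge0.
Qed.

Lemma kdual_norm_fin_num h : dual h -> dual_norm h \is a fin_num.
Proof.
move=> Dh; have [C C_gt0 hC] := mulsp_bounded ideal (L1_solid_space mu) Dh.
rewrite ge0_fin_numE ?kdual_norm_ge0//; apply: le_lt_trans (ltry C).
apply: kdual_norm_le => f Mf f1; apply: le_trans (hC _ Mf) _.
by rewrite -[leRHS]mule1 lee_wpmul2l// lee_fin ltW.
Qed.

Lemma hoelder_kdual h f : dual h -> mem f ->
  (L1_norm mu (fun x => h x * f x)%R <= dual_norm h * nrm f)%E.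
Proof.
move=> Dh Mf; have mh := kdual_mem_measurable Dh.
have normE := fineK (solid_fin_num ideal Mf).
have := fine_solid_norm_ge0 ideal Mf.
rewrite le_eqVlt => /predU1P[norm0|norm_gt0].
  have [C _ hC] := mulsp_bounded ideal (L1_solid_space mu) Dh.
  by have := hC _ Mf; rewrite -normE -norm0 !mule0.
have inv_gt0 : 0 < (fine (nrm f))^-1 by rewrite invr_gt0.
have := le_kdual_norm h (solid_memZ ideal (fine (nrm f))^-1 Mf).
rewrite (solid_normZ ideal)// gtr0_norm// -normE -EFinM mulVf ?gt_eqF//.
under eq_fun do rewrite mulrCA.
rewrite L1_normZ; last exact: measurable_mul_mem.
by rewrite gtr0_norm// lee_pdivrMl// muleC; exact.
Qed.

Lemma kdual_solid_space : solid_space mu dual dual_norm.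
Proof.
have solidL1 := L1_solid_space mu.
split.
- exact: kdual_mem_measurable.
- split.
  + split=> [|f Mf]; first exact: (measurable_cst (0 : R)).
    rewrite (_ : (fun x => _ * f x) = fun=> 0).
      exact: (solid_mem0 solidL1).
    by apply/funext => x; rewrite mul0r.
  + move=> h k [mh hL] [mk kL]; split=> [|f Mf]; first exact: measurable_funD.
    under eq_fun do rewrite mulrDl.
    by apply: (solid_memD solidL1); [exact: hL|exact: kL].
  + move=> a h [mh hL]; split=> [|f Mf]; first exact: measurable_funM.
    under eq_fun do rewrite -mulrA.
    by apply: (solid_memZ solidL1); exact: hL.
- exact: kdual_norm_fin_num.
- by move=> h _; exact: kdual_norm_ge0.
- move=> h k Dh Dk; apply: kdual_norm_le => f Mf f1.
  under eq_fun do rewrite mulrDl.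
  apply: le_trans (solid_normD solidL1 (Dh.2 _ Mf) (Dk.2 _ Mf)) _.
  by apply: leeD; exact: le_kdual_norm.
- move=> a h Dh; apply: kdual_norm_le => f Mf f1.
  under eq_fun do rewrite -mulrA.
  rewrite (solid_normZ solidL1) ?lee_wpmul2l ?le_kdual_norm//.
  exact: Dh.2.
- move=> h k mh Dk hk.
  have hkL f : mem f -> L1_mem mu (fun x => h x * f x) /\
      (L1_norm mu (fun x => h x * f x)%R <=
       L1_norm mu (fun x => k x * f x)%R)%E.
    move=> Mf; apply: (solid_le solidL1 (measurable_mul_mem mh Mf) (Dk.2 _ Mf)).
    by apply: filterS hk => x hkx; rewrite !normrM ler_wpM2r.
  split; first by split => // f /hkL[].
  apply: kdual_norm_le => f Mf f1.
  exact: le_trans (hkL f Mf).2 (le_kdual_norm _ _ _).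
Qed.

(* A weak unit e detects the a.e. finiteness of the dominating series, since
   the series of the u n * e converges in L1. *)
Lemma kdual_dominated : sigma_finite setT mu -> saturated mu mem ->
  norm_dominated mu dual dual_norm.
Proof.
move=> sf sat u Du unorm; have meas_u n := kdual_mem_measurable (Du n).
have [e Me e_gt0] := weak_unit ideal sat sf.
have meas_uM f n : mem f -> measurable_fun setT (fun x => u n x * f x).
  exact: measurable_mul_mem.
have uM_fin f : mem f ->
    (\sum_(0 <= n <oo) L1_norm mu (fun x => u n x * f x)%R < +oo)%E.
  move=> Mf; apply: le_lt_trans (ltry (2 * fine (nrm f))).
  apply: nneseries_le_half => n; first exact: L1_norm_ge0.
  apply: le_trans (hoelder_kdual (Du n) Mf) _.
  rewrite EFinM fineK ?(solid_fin_num ideal)// muleC lee_wpmul2l//.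
  exact: (solid_norm_ge0 ideal).
exists (abs_series u).
  split=> [|f Mf]; first exact: measurable_abs_series.
  apply: (solid_mem_le (L1_solid_space mu)
    (g := abs_series (fun n x => u n x * f x))).
  - by apply: measurable_mul_mem => //; exact: measurable_abs_series.
  - apply/L1_memP; split.
      by apply: measurable_abs_series => n; exact: meas_uM.
    apply: le_lt_trans (uM_fin f Mf).
    exact: L1_norm_abs_series_le (fun n => meas_uM f n Mf).
  - by move=> x; rewrite abs_seriesM normrM [leRHS]normrM normr_id.
move=> n; have := le_abs_series_ae (fun n => meas_uM e n Me) (uM_fin e Me) n.
apply: filterS => x.
by rewrite abs_seriesM normrM ler_pM2r ?normr_gt0 ?gt_eqF.
Qed.

Lemma kdual_ideal_space : sigma_finite setT mu -> saturated mu mem ->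
  ideal_space mu dual dual_norm.
Proof.
by move=> sf sat; split; [exact: kdual_solid_space|exact: kdual_dominated].
Qed.

Lemma sub_kdual_kdual f : mem f -> kdual_mem mu dual f.
Proof.
move=> Mf; split=> [|h Dh]; first exact: (solid_measurable ideal).
by under eq_fun do rewrite mulrC; exact: Dh.2.
Qed.

End KoetheDual.

(** * Order continuous functionals have densities *)

Section OrderIdeals.
Context {d : measure_display} {T : measurableType d} {R : realType}.
Implicit Types (v w u f : T -> R).

Definition order_ideal v : set (T -> R) :=
  [set u : T -> R | measurable_fun setT u /\
    exists c : R, forall x, `|u x| <= c * v x].

Definition bounded_measurable : set (T -> R) := order_ideal (fun=> 1).

Lemma order_ideal_subspace v : linear_subspace (order_ideal v).
Proof.
split.
- split; first exact: (measurable_cst (0 : R)).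
  by exists 0 => x; rewrite mul0r normr0.
- move=> f g [mf [a fa]] [mg [b gb]]; split; first exact: measurable_funD.
  exists (a + b) => x; rewrite mulrDl; apply: le_trans (ler_normD _ _) _.
  exact: lerD.
- move=> a f [mf [c fc]]; split; first exact: measurable_funM.
  by exists (`|a| * c) => x; rewrite normrM -mulrA ler_wpM2l.
Qed.

Lemma order_ideal_mulr v w : measurable_fun setT v -> (forall x, 0 <= v x) ->
  bounded_measurable w -> order_ideal v (fun x => w x * v x).
Proof.
move=> mv v_ge0 [mw [c wc]]; split; first exact: measurable_funM.
exists c => x; rewrite normrM (ger0_norm (v_ge0 x)) ler_wpM2r//.
by rewrite -[leRHS]mulr1.
Qed.

Lemma bounded_measurable_le1 w : measurable_fun setT w ->
  (forall x, `|w x| <= 1) -> bounded_measurable w.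
Proof. by move=> mw w1; split => //; exists 1 => x; rewrite mulr1. Qed.

Lemma normr_indic_le1 (A : set T) x : `|\1_A x : R| <= 1.
Proof. by rewrite indicE; case: (_ \in _); rewrite ?normr1 ?normr0. Qed.

Lemma bounded_measurable_indic (A : set T) : measurable A ->
  bounded_measurable (\1_A).
Proof.
move=> mA; apply: bounded_measurable_le1; last exact: normr_indic_le1.
exact: measurable_indic.
Qed.

End OrderIdeals.

Section UniformApproximation.
Context {d : measure_display} {T : measurableType d} {R : realType}.

Lemma sum_nat_le_truncn (N : nat) (t : R) : 0 <= t -> t <= N%:R ->
  \sum_(i < N) (i.+1%:R <= t)%R%:R = (Num.truncn t)%:R :> R.
Proof.
move=> t_ge0 tN; have truncN : (Num.truncn t <= N)%N.
  by rewrite -(@ler_nat R); apply: le_trans tN; rewrite truncn_le.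
under eq_bigr do rewrite -truncn_gt_nat.
rewrite -natr_sum -[in RHS](card_ord (Num.truncn t)) -sum1_card; congr (_%:R).
rewrite (big_ord_widen N (fun=> 1%N))// [RHS]big_mkcond.
by apply: eq_bigr => i _; case: (_ < _)%N.
Qed.

Variables (L : (T -> R) -> R) (C : R).
Hypothesis linL : linear_on bounded_measurable L.
Hypothesis L_le : forall w, bounded_measurable w -> (forall x, `|w x| <= 1) ->
  `|L w| <= C.
Hypothesis L_indic : forall A, measurable A -> L \1_A = 0.

Let subB : linear_subspace (@bounded_measurable _ T R).
Proof. exact: order_ideal_subspace. Qed.

(* The integer part of w is a sum of indicators, and is within 1 of w. *)
Lemma normr_linear_nonneg_le w : bounded_measurable w -> (forall x, 0 <= w x) ->
  `|L w| <= C.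
Proof.
move=> bw w_ge0; have [mw [c wc]] := bw; pose N := (Num.truncn c).+1.
have w_le x : w x <= N%:R.
  apply: le_trans (ler_norm _) (le_trans (wc x) _).
  by rewrite mulr1 ltW// truncnS_gt.
pose A i := [set x | i.+1%:R <= w x].
have mA i : measurable (A i).
  by rewrite -[X in measurable X]setTI; exact: measurable_fun_le.
have bA i : bounded_measurable (\1_(A i)) by exact: bounded_measurable_indic.
pose s := \sum_(i < N) \1_(A i) : T -> R.
have bs : bounded_measurable s by exact: linear_subspace_sum.
have Ls : L s = 0.
  by rewrite (linear_on_sum _ subB linL)// big1// => i _; exact: L_indic.
have sE x : s x = (Num.truncn (w x))%:R.
  rewrite /s fct_sumE -(sum_nat_le_truncn (w_ge0 x) (w_le x)).
  by apply: eq_bigr => i _; rewrite indicE mem_setE.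
have bNs := linear_subspace_funZ (-1) subB bs.
have -> : L w = L (fun x => w x + -1 * s x).
  by rewrite (linear_on_funD linL)// (linear_on_funZ _ linL)// Ls mulr0 addr0.
apply: L_le => [|x]; first exact: linear_subspace_funD.
have /andP[] := truncn_itv (w_ge0 x).
by rewrite sE -natr1 mulN1r => ? ?; rewrite ger0_norm; lra.
Qed.

Lemma linear_nonneg_eq0 w : bounded_measurable w -> (forall x, 0 <= w x) ->
  L w = 0.
Proof.
move=> bw w_ge0; apply: contrapT => /eqP Lw0.
have Lw_gt0 : 0 < `|L w| by rewrite normr_gt0.
pose m := (Num.truncn (C / `|L w|)).+1.
have /normr_linear_nonneg_le : bounded_measurable (fun x => m%:R * w x).
  exact: linear_subspace_funZ.
rewrite (linear_on_funZ _ linL)// normrM ger0_norm// -ler_pdivlMr//.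
by rewrite leNgt truncnS_gt => /(_ _)/negP; apply => // x; rewrite mulr_ge0.
Qed.

Lemma linear_bounded_measurable_eq0 w : bounded_measurable w -> L w = 0.
Proof.
move=> bw; have [_ [c wc]] := bw.
have b1 : bounded_measurable (\1_setT : T -> R).
  exact: bounded_measurable_indic.
have bc := linear_subspace_funZ c subB b1.
have := linear_nonneg_eq0 (linear_subspace_funD subB bw bc).
rewrite (linear_on_funD linL)// (linear_on_funZ _ linL)// L_indic// mulr0 addr0.
apply=> x; rewrite indicT mulr1; have := wc x; rewrite mulr1 ler_norml.
by move=> /andP[]; lra.
Qed.

End UniformApproximation.

Section ContinuityAtEmpty.
Context {d : measure_display} {T : measurableType d} {R : realType}.

Lemma additive_continuous_semi_sigma_additive (charge : set T -> R) :
  (forall A B, measurable A -> measurable B -> [disjoint A & B] ->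
    charge (A `|` B) = charge A + charge B) ->
  (forall A : nat -> set T, (forall n, measurable (A n)) ->
    nonincreasing_seq A -> \bigcap_n A n = set0 ->
    charge (A n) @[n --> \oo] --> 0) ->
  semi_sigma_additive (fun A => (charge A)%:E).
Proof.
move=> chargeU charge_cvg0 E mE disjE _.
pose tail n := \bigcup_(i >= n) E i.
have mtail n : measurable (tail n) by apply: bigcup_measurable => i _.
have Etail n : [disjoint E n & tail n.+1].
  rewrite disj_set2E; apply/eqP; rewrite -subset0 => x [En [i /= ni Ei]].
  have n_eq_i := disjE n i Logic.I Logic.I (ex_intro _ x (conj En Ei)).
  by move: ni; rewrite n_eq_i ltnn.
have tailE n : tail n = E n `|` tail n.+1.
  apply/seteqP; split => x.
    move=> [i /= ni Ei]; move: ni; rewrite leq_eqVlt => /predU1P[->|ni].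
      by left.
    by right; exists i.
  by move=> [En|[i /= ni Ei]]; [exists n => /=|exists i => //=; exact: ltnW].
have sumE n : (\sum_(0 <= i < n) (charge (E i))%:E)%E =
    (charge (\bigcup_i E i) - charge (tail n))%:E.
  elim: n => [|n IH].
    have -> : tail 0 = \bigcup_i E i by apply: eq_bigcupl.
    by rewrite big_nil subrr.
  by rewrite big_nat_recr//= IH -EFinD (tailE n) chargeU//; congr EFin; ring.
rewrite (funext sumE); apply: cvg_EFin; first exact: nearW.
rewrite -[X in _ --> X]subr0; apply: cvgB; first exact: cvg_cst.
apply: charge_cvg0 => //.
  apply/nonincreasing_seqP => n; apply/subsetPset => x [i /= ni Ei].
  by exists i => //=; exact: ltnW.
rewrite -subset0 => x capx; have [i _ Ei] := capx 0%N Logic.I.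
have [j /= ij Ej] := capx i.+1 Logic.I.
have i_eq_j := disjE i j Logic.I Logic.I (ex_intro _ x (conj Ei Ej)).
by move: ij; rewrite i_eq_j ltnn.
Qed.

Lemma indic_setU (A B : set T) x : [disjoint A & B] ->
  \1_(A `|` B) x = \1_A x + \1_B x :> R.
Proof.
move=> AB; rewrite !indicE in_setU.
have [xA|] := boolP (x \in A); last by rewrite add0r.
rewrite (_ : x \in B = false) ?addr0//; apply/negbTE/negP => xB.
by move/disj_setPS: AB => /(_ x) []; split; exact: set_mem.
Qed.

End ContinuityAtEmpty.

Section Densities.
Context {d : measure_display} {T : measurableType d} {R : realType}.
Variable mu : {measure set T -> \bar R}.
Implicit Types (v f g u : T -> R) (F : (T -> R) -> R).

Definition abs_continuous_norm (nrm : (T -> R) -> \bar R) f :=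
  forall A : nat -> set T, (forall n, measurable (A n)) ->
    nonincreasing_seq A -> \bigcap_n A n = set0 ->
    nrm (fun x => \1_(A n) x * f x) @[n --> \oo] --> 0%E.

Definition is_density v F g := [/\ measurable_fun setT g,
  forall x, v x = 0 -> g x = 0 &
  forall u, order_ideal v u -> L1_mem mu (fun x => g x * u x) /\
    \int[mu]_x (g x * u x) = F u].

Lemma bigcap0_near (A : nat -> set T) x : nonincreasing_seq A ->
  \bigcap_n A n = set0 -> \forall n \near \oo, ~ A n x.
Proof.
move=> nA A0; have [N ANx] : exists N, ~ A N x.
  by apply/existsNP => Ax; have : (\bigcap_n A n) x by []; rewrite A0.
exists N => // n /= Nn Anx; apply: ANx.
by have /subsetPset := nA _ _ Nn; exact.
Qed.

Lemma abs_continuous_L1_norm f : L1_mem mu f ->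
  abs_continuous_norm (L1_norm mu) f.
Proof.
move=> Lf A mA nA A0; have mf := L1_mem_measurable Lf.
have [|||||_ _ cv] := @dominated_convergence _ _ _ mu _ measurableT
    (fun n x => (`|\1_(A n) x * f x|)%:E) (cst 0%E) (fun x => (`|f x|)%:E).
- move=> n; apply: measurable_EFin_normr; apply: measurable_funM => //.
- exact: measurable_cst.
- apply: aeW => x _; apply: cvg_near_cst; apply: filterS (bigcap0_near x nA A0).
  by move=> n Anx; rewrite indicE memNset// mul0r normr0.
- exact: integrable_norm.
- apply: aeW => x n _; rewrite lee_fin normr_id normrM ler_piMl//.
  exact: normr_indic_le1.
by move: cv; rewrite integral0.
Qed.

Lemma linear_on_Rintegral :
  linear_on (L1_mem mu) (fun f => \int[mu]_x f x).
Proof.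
by split=> [f g Lf Lg|a f Lf]; [exact: RintegralD|exact: RintegralZl].
Qed.

Lemma L1_mem_mul_bounded k w : L1_mem mu k -> bounded_measurable w ->
  L1_mem mu (fun x => k x * w x).
Proof.
move=> Lk [mw [c wc]]; have mk := L1_mem_measurable Lk.
apply: (solid_mem_le (L1_solid_space mu) (g := fun x => c * k x)).
- exact: measurable_funM.
- exact: (solid_memZ (L1_solid_space mu)).
- move=> x; rewrite !normrM mulrC ler_wpM2r//.
  by have := wc x; rewrite mulr1 => /le_trans; apply; exact: ler_norm.
Qed.

Lemma measurable_fun_inv f : measurable_fun setT f -> (forall x, 0 <= f x) ->
  measurable_fun setT (fun x => (f x)^-1).
Proof.
move=> mf f_ge0; rewrite (_ : (fun x => _) = fun x => powR (f x) (-1)).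
  exact: measurableT_comp (measurable_powR _) mf.
by apply/funext => x; rewrite -powR_inv1.
Qed.

Lemma measurable_fun_sg f : measurable_fun setT f ->
  measurable_fun setT (fun x => Num.sg (f x)).
Proof.
move=> mf; rewrite (_ : (fun x => _) =
    fun x => if 0 < f x then 1 else if f x < 0 then -1 else 0).
  apply: measurable_fun_ifT => //; first exact: measurable_fun_ltr.
  by apply: measurable_fun_ifT => //; exact: measurable_fun_ltr.
by apply/funext => x; case: sgrP.
Qed.

Lemma normr_sg_le1 (a : R) : `|Num.sg a| <= 1.
Proof. by rewrite normr_sg; case: (_ == _). Qed.

End Densities.

Section SigmaFiniteAlias.
Context {d : measure_display} {T : measurableType d} {R : realType}.
Variables (mu : {measure set T -> \bar R}) (sf : sigma_finite setT mu).

(* Carries the hypothesis sf, so that mu becomes an instance of a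
   sigma-finite measure. *)
Definition sigma_finite_alias of sigma_finite setT mu : set T -> \bar R := mu.

HB.instance Definition _ := Measure.copy (sigma_finite_alias sf) mu.
HB.instance Definition _ :=
  Measure_isSigmaFinite.Build _ _ _ (sigma_finite_alias sf) sf.

End SigmaFiniteAlias.

Section Representation.
Context {d : measure_display} {T : measurableType d} {R : realType}.
Variable mu : {measure set T -> \bar R}.
Hypothesis sf : sigma_finite setT mu.
Variables (mem : (T -> R) -> Prop) (nrm : (T -> R) -> \bar R).
Hypothesis solid : solid_space mu mem nrm.
Variables (F : (T -> R) -> R) (C : R).
Hypotheses (linF : linear_on mem F) (C_ge0 : 0 <= C).
Hypothesis F_le : forall f, mem f -> F f <= C * fine (nrm f).

Lemma normr_functional_le f : mem f -> `|F f| <= C * fine (nrm f).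
Proof.
move=> Mf; rewrite ler_norml F_le// andbT lerNl.
rewrite -mulN1r -(linear_on_funZ _ linF)//.
apply: le_trans (F_le (solid_memZ solid _ Mf)) _.
by rewrite (solid_normZ solid)// normrN1 mul1e.
Qed.

Lemma functional_indic_cvg0 f : mem f -> abs_continuous_norm nrm f ->
  forall A : nat -> set T, (forall n, measurable (A n)) ->
    nonincreasing_seq A -> \bigcap_n A n = set0 ->
    F (fun x => \1_(A n) x * f x) @[n --> \oo] --> 0.
Proof.
move=> Mf acf A mA nA A0.
have bound_cvg0 : C * fine (nrm (fun x => \1_(A n) x * f x)) @[n --> \oo] --> 0.
  rewrite -(mulr0 C); apply: cvgMl_tmp.
  by have /fine_cvg := acf A mA nA A0.
apply: norm_cvg0; apply: (squeeze_cvgr _ (cvg_cst 0) bound_cvg0).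
apply: nearW => n; rewrite normr_ge0/= normr_functional_le//.
apply: (solid_mem_mul_le1 solid) => //; exact: normr_indic_le1.
Qed.

Lemma functional_indic_cvg f : mem f -> abs_continuous_norm nrm f ->
  forall A : nat -> set T, (forall n, measurable (A n)) ->
    nondecreasing_seq A -> (forall x, \forall n \near \oo, A n x) ->
    F (fun x => \1_(A n) x * f x) @[n --> \oo] --> F f.
Proof.
move=> Mf acf A mA nA A_near.
have indic_mem B : measurable B -> mem (fun x => \1_B x * f x).
  by move=> mB; apply: (solid_mem_mul_le1 solid) => //; exact: normr_indic_le1.
have FE n : F (fun x => \1_(A n) x * f x) =
    F f - F (fun x => \1_(~` A n) x * f x).
  have mAC := measurableC (mA n).
  apply/eqP; rewrite eq_sym subr_eq.
  rewrite -(linear_on_funD linF (indic_mem _ (mA n)) (indic_mem _ mAC)).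
  apply/eqP; congr F; apply/funext => x; rewrite -mulrDl !indicE in_setC.
  by case: (x \in A n); rewrite ?addr0 ?add0r mul1r.
rewrite (funext FE) -[X in _ --> X]subr0; apply: cvgB; first exact: cvg_cst.
apply: functional_indic_cvg0 => // [n|i j ij|].
- exact: measurableC.
- by apply/subsetPset/subsetC; apply/subsetPset; exact: nA.
- rewrite -subset0 => x capx; have [N _ /(_ N (leqnn N)) ANx] := A_near x.
  exact: (capx N).
Qed.

Variable v : T -> R.
Hypotheses (Mv : mem v) (v_ge0 : forall x, 0 <= v x).
Hypothesis acv : abs_continuous_norm nrm v.

Let mv : measurable_fun setT v. Proof. exact: (solid_measurable solid). Qed.

Lemma sub_order_ideal u : order_ideal v u -> mem u.
Proof.
move=> [meas_u [c uc]].
apply: (solid_mem_le solid meas_u (solid_memZ solid c Mv)) => x.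
by apply: le_trans (uc x) (ler_norm _).
Qed.

Let mul_mem w : bounded_measurable w -> mem (fun x => w x * v x).
Proof. by move=> bw; apply: sub_order_ideal; exact: order_ideal_mulr. Qed.

Definition functional_charge (A : set T) : \bar R :=
  (F (fun x => \1_A x * v x))%:E.

Let charge_set0 : functional_charge set0 = 0%E.
Proof.
rewrite /functional_charge; congr EFin.
rewrite (_ : (fun x => _) = fun x => 0 * v x); last first.
  by apply/funext => x; rewrite indic0.
by rewrite (linear_on_funZ _ linF)// mul0r.
Qed.

Let charge_fin A : measurable A -> functional_charge A \is a fin_num.
Proof. by []. Qed.

Let charge_sigma_additive : semi_sigma_additive functional_charge.
Proof.
apply: additive_continuous_semi_sigma_additive => [A B mA mB AB|].
  under eq_fun do rewrite indic_setU// mulrDl.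
  by rewrite (linear_on_funD linF)//; exact/mul_mem/bounded_measurable_indic.
exact: functional_indic_cvg0.
Qed.

HB.instance Definition _ := isCharge.Build d T R functional_charge
  charge_set0 charge_fin charge_sigma_additive.

Lemma functional_charge_density : exists k : T -> R, L1_mem mu k /\
  forall A, measurable A ->
    \int[mu]_x (k x * \1_A x) = F (fun x => \1_A x * v x).
Proof.
pose muS : {sigma_finite_measure set T -> \bar R} := sigma_finite_alias sf.
have dom : functional_charge `<< muS.
  apply/null_content_dominatesP => A mA A0; congr EFin; apply/eqP.
  have MA : mem (fun x => \1_A x * v x).
    exact/mul_mem/bounded_measurable_indic.
  rewrite -normr_le0; apply: le_trans (normr_functional_le MA) _.
  have : (nrm (fun x => \1_A x * v x)%R <= nrm (fun=> 0%R))%E.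
    apply: (solid_le solid (solid_measurable solid MA) (solid_mem0 solid) _).2.
    exists A; split => // x /= nonzero; apply: contrapT => Ax; apply: nonzero.
    by rewrite indicE memNset// mul0r.
  rewrite (solid_norm0 solid) -(le_fine_solid_norm solid)// => norm_le0.
  by rewrite mulr_ge0_le0.
pose k x := fine (Radon_Nikodym functional_charge muS x).
have kE x : (k x)%:E = Radon_Nikodym functional_charge muS x.
  by rewrite fineK//; exact: Radon_Nikodym_fin_num.
have Lk : L1_mem mu k.
  by rewrite /L1_mem (funext kE); exact: (Radon_Nikodym_integrable dom).
exists k; split => // A mA; have kA := Radon_Nikodym_integral dom mA.
apply: EFin_inj; rewrite -[RHS]/(functional_charge A) [RHS]kA EFin_Rintegral.
  rewrite [RHS]integral_mkcond; apply: eq_integral => x _.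
  by rewrite patchE -kE indicE; case: ifPn; rewrite ?mulr1 ?mulr0.
under eq_fun do rewrite mulrC.
apply: (solid_mem_mul_le1 (L1_solid_space mu)) => //; exact: normr_indic_le1.
Qed.

Lemma functional_charge_density_bounded : exists k : T -> R, L1_mem mu k /\
  forall w, bounded_measurable w ->
    \int[mu]_x (k x * w x) = F (fun x => w x * v x).
Proof.
have [k [Lk kA]] := functional_charge_density; exists k; split => // w bw.
pose L w := \int[mu]_x (k x * w x) - F (fun x => w x * v x).
have linL : linear_on bounded_measurable L.
  split=> [f g bf bg|a f bf]; have Lkf := L1_mem_mul_bounded Lk bf.
    have Lkg := L1_mem_mul_bounded Lk bg; rewrite /L.
    under eq_Rintegral do rewrite mulrDr.
    under [X in F X]eq_fun do rewrite mulrDl.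
    rewrite RintegralD// (linear_on_funD linF); [ring|exact: mul_mem..].
  rewrite /L; under eq_Rintegral do rewrite mulrCA.
  under [X in F X]eq_fun do rewrite -mulrA.
  by rewrite RintegralZl// (linear_on_funZ _ linF); [ring|exact: mul_mem].
apply: subr0_eq; rewrite -/(L w).
apply: (linear_bounded_measurable_eq0 linL
  (C := \int[mu]_x `|k x| + C * fine (nrm v))) => // [f bf f1|A mA]; last first.
  by rewrite /L kA// subrr.
apply: le_trans (ler_normB _ _) _; apply: lerD.
  have Lkf := L1_mem_mul_bounded Lk bf.
  apply: le_trans (le_normr_Rintegral measurableT Lkf) _.
  apply: le_Rintegral => //; [exact: integrable_norm|exact: integrable_norm|].
  by move=> x _; rewrite normrM ler_piMr.
have Mf := mul_mem bf; apply: le_trans (normr_functional_le Mf) _.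
rewrite ler_wpM2l// (le_fine_solid_norm solid) ?fineK ?(solid_fin_num solid)//.
by apply: (solid_norm_mul_le1 solid) => //; case: bf.
Qed.

Theorem exists_density : exists g, is_density mu v F g.
Proof.
have [k [Lk kF]] := functional_charge_density_bounded.
have mk := L1_mem_measurable Lk; have mVv := measurable_fun_inv mv v_ge0.
exists (fun x => k x * (v x)^-1); split => [|x ->|u [meas_u [c uc]]].
- exact: measurable_funM.
- by rewrite invr0 mulr0.
have bw : bounded_measurable (fun x => (v x)^-1 * u x).
  split; first exact: measurable_funM.
  exists `|c| => x; rewrite mulr1 mulrC normrM normfV (ger0_norm (v_ge0 x)).
  have [->|vx0] := eqVneq (v x) 0; first by rewrite invr0 mulr0.
  rewrite ler_pdivrMr ?lt0r ?vx0 ?v_ge0//.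
  by apply: le_trans (uc x) _; rewrite ler_wpM2r// ler_norm.
under eq_Rintegral do rewrite /= -mulrA.
under eq_fun do rewrite /= -mulrA; split; first exact: L1_mem_mul_bounded.
rewrite kF//; congr F; apply/funext => x.
have [vx0|vx0] := eqVneq (v x) 0; last by rewrite mulrAC mulVf// mul1r.
by rewrite vx0 mulr0; apply/esym/normr0_eq0/eqP; rewrite -normr_le0 normr_id
  -[leRHS](mulr0 c) -vx0.
Qed.

End Representation.

Section Truncation.
Context {d : measure_display} {T : measurableType d} {R : realType}.
Variable mu : {measure set T -> \bar R}.
Implicit Types (v f u : T -> R).

Definition level_set v f n := [set x | `|f x| <= n%:R * v x].

Lemma measurable_level_set v f n : measurable_fun setT v ->
  measurable_fun setT f -> measurable (level_set v f n).
Proof.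
move=> mv mf; rewrite -[X in measurable X]setTI; apply: measurable_fun_le => //.
  exact: measurable_fun_normr.
exact: measurable_funM.
Qed.

Lemma nondecreasing_level_set v f : (forall x, 0 <= v x) ->
  nondecreasing_seq (level_set v f).
Proof.
move=> v_ge0 i j ij; apply/subsetPset => x /= /le_trans; apply.
by rewrite ler_wpM2r// ler_nat.
Qed.

Lemma level_set_near v f x : 0 < v x -> \forall n \near \oo, level_set v f n x.
Proof.
move=> vx_gt0; exists (Num.truncn (`|f x| / v x)).+1 => // n /= Nn.
rewrite /level_set/= -ler_pdivrMr//; apply: le_trans (ltW (truncnS_gt _)) _.
by rewrite ler_nat.
Qed.

Lemma cvg_indic_level_set v f x (a : R) : 0 < v x ->
  \1_(level_set v f n) x * a @[n --> \oo] --> a.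
Proof.
move=> vx_gt0; apply: cvg_near_cst; apply: filterS (level_set_near f vx_gt0).
by move=> n levelx; rewrite indicE mem_set// mul1r.
Qed.

Lemma order_ideal_indic_level_set v f u n : measurable_fun setT v ->
  (forall x, 0 <= v x) -> measurable_fun setT f -> measurable_fun setT u ->
  (forall x, `|u x| <= `|f x|) ->
  order_ideal v (fun x => \1_(level_set v f n) x * u x).
Proof.
move=> mv v_ge0 mf meas_u uf; split.
  apply: measurable_funM => //.
  by apply: measurable_indic; exact: measurable_level_set.
exists n%:R => x; rewrite indicE.
have [/set_mem levelx|_] := boolP (x \in level_set v f n).
  by rewrite mul1r; apply: le_trans (uf x) levelx.
by rewrite mul0r normr0 mulr_ge0.
Qed.

Variables (v : T -> R) (F : (T -> R) -> R) (g : T -> R).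
Hypotheses (mv : measurable_fun setT v) (v_ge0 : forall x, 0 <= v x).
Hypothesis gF : is_density mu v F g.

Lemma L1_norm_density_le f (c : R) : measurable_fun setT f ->
  (forall u, order_ideal v u -> (forall x, `|u x| <= `|f x|) -> F u <= c) ->
  (L1_norm mu (fun x => g x * f x)%R <= c%:E)%E.
Proof.
move=> mf Fc; have [mg g0 gint] := gF.
pose signed x := Num.sg (g x) * `|f x|.
have msigned : measurable_fun setT signed.
  apply: measurable_funM; first exact: measurable_fun_sg.
  exact: measurable_fun_normr.
have signed_le x : `|signed x| <= `|f x|.
  by rewrite normrM normr_id ler_piMl// normr_sg_le1.
pose u n x := \1_(level_set v f n) x * signed x.
have u_ideal n : order_ideal v (u n) by exact: order_ideal_indic_level_set.
have guE n x : g x * u n x = \1_(level_set v f n) x * `|g x * f x|.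
  by rewrite /u /signed normrM (normrEsg (g x)); ring.
have gu_le n :
    (\int[mu]_x (\1_(level_set v f n) x * `|g x * f x|)%:E <= c%:E)%E.
  have [Lgu Fgu] := gint _ (u_ideal n).
  under eq_integral do rewrite -guE.
  rewrite -EFin_Rintegral// Fgu lee_fin Fc// => x.
  rewrite /u normrM; apply: le_trans (signed_le x).
  by rewrite ler_piMl// normr_indic_le1.
have gu_cvg x : (\1_(level_set v f n) x * `|g x * f x|)%:E @[n --> \oo] -->
    (`|g x * f x|)%:E.
  apply: cvg_EFin; first exact: nearW.
  have [vx0|vx0] := eqVneq (v x) 0.
    by rewrite g0// mul0r normr0; under eq_fun do rewrite mulr0; exact: cvg_cst.
  by apply: cvg_indic_level_set; rewrite lt_neqAle eq_sym vx0 v_ge0.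
have lim_gu x : limn (fun n => (\1_(level_set v f n) x * `|g x * f x|)%:E) =
    (`|g x * f x|)%:E by apply: cvg_lim => //; exact: gu_cvg.
have := @cvg_monotone_convergence _ _ _ mu _ measurableT
  (fun n x => (\1_(level_set v f n) x * `|g x * f x|)%:E).
rewrite (funext lim_gu) => mono; apply: (cvge_to_le (mono _ _ _)).
- move=> n; apply/measurable_EFinP; under eq_fun do rewrite -guE.
  by apply: measurable_funM => //; case: (u_ideal n).
- by move=> n x _; rewrite lee_fin mulr_ge0// indicE.
- move=> x _ i j ij; rewrite lee_fin ler_wpM2r// !indicE ler_nat.
  have [/set_mem xi|//] := boolP (x \in level_set v f i).
  rewrite mem_set//.
  by move/subsetPset: (nondecreasing_level_set f v_ge0 ij); exact.
- exact: nearW.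
Qed.

End Truncation.

Section RepresentationOfAbsContinuous.
Context {d : measure_display} {T : measurableType d} {R : realType}.
Variable mu : {measure set T -> \bar R}.
Variables (mem : (T -> R) -> Prop) (nrm : (T -> R) -> \bar R).
Hypothesis solid : solid_space mu mem nrm.
Variables (F : (T -> R) -> R) (C : R).
Hypotheses (linF : linear_on mem F) (C_ge0 : 0 <= C).
Hypothesis F_le : forall f, mem f -> F f <= C * fine (nrm f).

Theorem representation_abs_continuous v : sigma_finite setT mu ->
  mem v -> (forall x, 0 < v x) -> abs_continuous_norm nrm v ->
  exists2 g : T -> R, measurable_fun setT g &
    forall f, mem f -> abs_continuous_norm nrm f ->
      L1_mem mu (fun x => g x * f x) /\ \int[mu]_x (g x * f x) = F f.
Proof.
move=> sf Mv v_gt0 acv; have v_ge0 x : 0 <= v x := ltW (v_gt0 x).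
have mv := solid_measurable solid Mv.
have [g gF] := exists_density sf solid linF C_ge0 F_le Mv v_ge0 acv.
have [mg _ gint] := gF; exists g => // f Mf acf.
have mf := solid_measurable solid Mf.
have Lgf : L1_mem mu (fun x => g x * f x).
  apply/L1_memP; split; first exact: measurable_funM.
  apply: le_lt_trans (ltry (C * fine (nrm f))).
  apply: (L1_norm_density_le mv v_ge0 gF mf) => u u_ideal uf.
  have Mu := sub_order_ideal solid Mv u_ideal.
  apply: le_trans (F_le Mu) _; rewrite ler_wpM2l//.
  rewrite (le_fine_solid_norm solid)// fineK ?(solid_fin_num solid)//.
  by apply: (solid_norm_le solid) => //; exact: (solid_measurable solid).
split => //; pose A := level_set v f.
have mA n : measurable (A n) by exact: measurable_level_set.
have nA : nondecreasing_seq A by exact: nondecreasing_level_set.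
have A_near x : \forall n \near \oo, A n x by exact: level_set_near.
have Rint_le h : L1_mem mu h -> \int[mu]_x h x <= 1 * fine (L1_norm mu h).
  move=> Lh; have fin_h := solid_fin_num (L1_solid_space mu) Lh.
  by rewrite mul1r -lee_fin (fineK fin_h); exact: Rintegral_le_L1_norm.
have F_cvg := functional_indic_cvg solid linF F_le Mf acf mA nA A_near.
have := functional_indic_cvg (L1_solid_space mu) (linear_on_Rintegral mu)
  Rint_le Lgf (abs_continuous_L1_norm Lgf) mA nA A_near.
rewrite (_ : (fun n => _) = fun n => F (fun x => \1_(A n) x * f x)).
  by move=> /cvg_unique; apply.
apply/funext => n.
have [|_ <-] := gint (fun x => \1_(A n) x * f x).
  exact: order_ideal_indic_level_set.
by apply: eq_Rintegral => x _; rewrite mulrCA.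
Qed.

End RepresentationOfAbsContinuous.

(** * Saturation of the Koethe dual *)

Section InfimalConvolution.
Context {d : measure_display} {T : measurableType d} {R : realType}.
Variable mu : {measure set T -> \bar R}.
Variables (mem1 mem2 : (T -> R) -> Prop) (nrm1 nrm2 : (T -> R) -> \bar R).
Hypotheses (ideal1 : ideal_space mu mem1 nrm1)
  (ideal2 : ideal_space mu mem2 nrm2).
Implicit Types u f : T -> R.

Definition split_norm u f := fine (nrm1 f) + fine (nrm2 (fun x => u x - f x)).

Definition inf_conv u := inf [set split_norm u f | f in mem1 `&` mem2].

Let split_norm_ge0 u f : mem2 u -> mem1 f -> mem2 f -> 0 <= split_norm u f.
Proof.
move=> M2u M1f M2f; apply: addr_ge0; first exact: (fine_solid_norm_ge0 ideal1).
by apply: (fine_solid_norm_ge0 ideal2); exact: (solid_memB ideal2).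
Qed.

Let has_inf_split_norm u : mem2 u ->
  has_inf [set split_norm u f | f in mem1 `&` mem2].
Proof.
move=> M2u; split.
  exists (split_norm u (fun=> 0)), (fun=> 0) => //.
  by split; [exact: (solid_mem0 ideal1)|exact: (solid_mem0 ideal2)].
by exists 0 => _ [f [M1f M2f] <-]; exact: split_norm_ge0.
Qed.

Lemma inf_conv_le u f : mem2 u -> mem1 f -> mem2 f ->
  inf_conv u <= fine (nrm1 f) + fine (nrm2 (fun x => u x - f x)).
Proof.
move=> M2u M1f M2f; apply: ge_inf; last by exists f.
by case: (has_inf_split_norm M2u).
Qed.

Lemma le_inf_conv u (c : R) : mem2 u -> (forall f, mem1 f -> mem2 f ->
  c <= fine (nrm1 f) + fine (nrm2 (fun x => u x - f x))) -> c <= inf_conv u.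
Proof.
move=> M2u c_le; apply: lb_le_inf; first by case: (has_inf_split_norm M2u).
by move=> _ [f [M1f M2f] <-]; exact: c_le.
Qed.

Lemma inf_conv_ge0 u : mem2 u -> 0 <= inf_conv u.
Proof.
by move=> M2u; apply: le_inf_conv => // f M1f M2f; exact: split_norm_ge0.
Qed.

Lemma inf_conv_le_norm1 u : mem1 u -> mem2 u -> inf_conv u <= fine (nrm1 u).
Proof.
move=> M1u M2u; have := inf_conv_le M2u M1u M2u.
by under eq_fun do rewrite subrr; rewrite (solid_norm0 ideal2) addr0.
Qed.

Lemma inf_conv_le_norm2 u : mem2 u -> inf_conv u <= fine (nrm2 u).
Proof.
move=> M2u; have := inf_conv_le M2u (solid_mem0 ideal1) (solid_mem0 ideal2).
by rewrite (solid_norm0 ideal1) add0r; under eq_fun do rewrite subr0.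
Qed.

Let inf_convD u w : mem2 u -> mem2 w ->
  inf_conv (fun x => u x + w x) <= inf_conv u + inf_conv w.
Proof.
move=> M2u M2w; rewrite -lerBlDr; apply: le_inf_conv => // f M1f M2f.
rewrite lerBlDl -lerBlDr; apply: le_inf_conv => // k M1k M2k; rewrite lerBlDl.
have := inf_conv_le (solid_memD ideal2 M2u M2w) (solid_memD ideal1 M1f M1k)
  (solid_memD ideal2 M2f M2k).
move/le_trans; apply; rewrite addrACA; apply: lerD.
  rewrite (le_fine_solid_norm ideal1); last exact: (solid_memD ideal1).
  rewrite EFinD !fineK ?(solid_fin_num ideal1)//.
  exact: (solid_normD ideal1).
have M2uf := solid_memB ideal2 M2u M2f; have M2wk := solid_memB ideal2 M2w M2k.
under eq_fun do rewrite opprD addrACA.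
rewrite (le_fine_solid_norm ideal2); last exact: (solid_memD ideal2).
by rewrite EFinD !fineK ?(solid_fin_num ideal2)//; exact: (solid_normD ideal2).
Qed.

Let inf_convZ a u : 0 <= a -> mem2 u ->
  inf_conv (fun x => a * u x) <= a * inf_conv u.
Proof.
rewrite le_eqVlt => /predU1P[<- M2u|a_gt0 M2u].
  have M20u := solid_memZ ideal2 0 M2u.
  rewrite mul0r; apply: le_trans (inf_conv_le_norm2 M20u) _.
  by rewrite (solid_normZ ideal2)// normr0 mul0e.
rewrite -ler_pdivrMl//; apply: le_inf_conv => // f M1f M2f.
rewrite ler_pdivrMl//.
have := inf_conv_le (solid_memZ ideal2 a M2u) (solid_memZ ideal1 a M1f)
  (solid_memZ ideal2 a M2f).
under [X in nrm2 X]eq_fun do rewrite -mulrBr.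
have M2uf := solid_memB ideal2 M2u M2f.
rewrite (solid_normZ ideal1)// (solid_normZ ideal2)// gtr0_norm// mulrDr.
by rewrite !fineM ?(solid_fin_num ideal1) ?(solid_fin_num ideal2).
Qed.

Lemma inf_conv_sublinear : sublinear_on mem2 inf_conv.
Proof. by split=> [u w|a u]; [exact: inf_convD|exact: inf_convZ]. Qed.

(* A sequence f n with nrm1 (f n) + nrm2 (u - f n) <= 4 ^- n converges a.e. both
   to 0 and to u. *)
Lemma inf_conv_eq0_ae u : mem2 u -> inf_conv u = 0 ->
  {ae mu, forall x, u x = 0}.
Proof.
move=> M2u u0.
have /choice[f fP] n :
    exists f, [/\ mem1 f, mem2 f & split_norm u f < 4^-1 ^+ n].
  have e_gt0 : 0 < (4^-1 : R) ^+ n by rewrite exprn_gt0// invr_gt0.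
  have [_ [f [M1f M2f] <-]] := inf_adherent e_gt0 (has_inf_split_norm M2u).
  by rewrite -/(inf_conv u) u0 add0r; exists f.
have f0 : {ae mu, forall x, f n x @[n --> \oo] --> 0}.
  apply: (ideal_cvg0_ae ideal1 ltr01) => n; have [M1f M2f fn] := fP n => //.
  rewrite mul1r -(le_fine_solid_norm ideal1)//; apply: le_trans (ltW fn).
  rewrite lerDl (fine_solid_norm_ge0 ideal2)//; exact: (solid_memB ideal2).
have uf0 : {ae mu, forall x, u x - f n x @[n --> \oo] --> 0}.
  apply: (ideal_cvg0_ae ideal2 ltr01) => n; have [M1f M2f fn] := fP n.
    exact: (solid_memB ideal2).
  rewrite mul1r -(le_fine_solid_norm ideal2); last exact: (solid_memB ideal2).
  by apply: le_trans (ltW fn); rewrite lerDr (fine_solid_norm_ge0 ideal1).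
apply: filterS2 f0 uf0 => x fx ufx.
have : u x - f n x + f n x @[n --> \oo] --> 0 + (0 : R) by exact: cvgD.
under eq_fun do rewrite subrK.
by rewrite addr0 => cvu; exact: (cvg_unique _ (cvg_cst _) cvu).
Qed.

End InfimalConvolution.

Section KoetheDualSaturated.
Context {d : measure_display} {T : measurableType d} {R : realType}.
Variable mu : {measure set T -> \bar R}.
Variables (mem : (T -> R) -> Prop) (nrm : (T -> R) -> \bar R).
Hypotheses (ideal : ideal_space mu mem nrm) (sf : sigma_finite setT mu).

Lemma exists_kdual_nonzero_on v :
  mem v -> L1_mem mu v -> (forall x, 0 <= v x) ->
  ~ {ae mu, forall x, v x = 0} ->
  exists2 g, kdual_mem mu mem g & ~ {ae mu, forall x, v x != 0 -> g x = 0}.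
Proof.
move=> Mv Lv v_ge0 v_neq0.
have idealL1 := L1_ideal_space mu; have mv := L1_mem_measurable Lv.
pose q := inf_conv mem (L1_mem mu) nrm (L1_norm mu).
have qv_gt0 : 0 < q v.
  rewrite lt_neqAle (inf_conv_ge0 ideal idealL1)// andbT; apply/eqP => qv0.
  apply: v_neq0; exact: (inf_conv_eq0_ae ideal idealL1).
have [F [linF Fq Fv]] := supporting_functional (solid_subspace idealL1)
  (inf_conv_sublinear ideal idealL1) Lv.
have F_le u : L1_mem mu u -> F u <= 1 * fine (L1_norm mu u).
  move=> Lu; rewrite mul1r; apply: le_trans (Fq _ Lu) _.
  exact: (inf_conv_le_norm2 ideal).
have [g gF] := exists_density sf idealL1 linF ler01 F_le Lv v_ge0
  (abs_continuous_L1_norm Lv).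
have [mg g0 gint] := gF; exists g.
  split=> // f Mf; have mf := solid_measurable ideal Mf.
  apply/L1_memP; split; first exact: measurable_funM.
  apply: le_lt_trans (ltry (fine (nrm f))).
  apply: (L1_norm_density_le mv v_ge0 gF mf) => u u_ideal uf.
  have Lu := sub_order_ideal idealL1 Lv u_ideal.
  have meas_u := L1_mem_measurable Lu.
  have Mu := solid_mem_le ideal meas_u Mf uf.
  apply: le_trans (Fq _ Lu) _.
  apply: le_trans (inf_conv_le_norm1 ideal idealL1 Mu Lu) _.
  rewrite (le_fine_solid_norm ideal)// fineK ?(solid_fin_num ideal)//.
  exact: (solid_norm_le ideal).
move=> gv0; move: qv_gt0; rewrite /q -Fv.
have [|_ <-] := gint v.
  by split => //; exists 1 => x; rewrite mul1r ger0_norm.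
have mgv : measurable_fun setT (fun x => g x * v x) by exact: measurable_funM.
rewrite (_ : Rintegral _ _ _ = 0) ?ltxx// /Rintegral.
rewrite (@ae_eq_integral _ _ _ mu setT (cst 0%E)) ?integral0//.
  exact/measurable_EFinP.
apply: filterS gv0 => x gv0 _; congr EFin.
by have [->|/gv0 ->] := eqVneq (v x) 0; rewrite ?mulr0 ?mul0r.
Qed.

Lemma exists_mem_L1_nonzero_on (A : set T) : saturated mu mem ->
  measurable A -> (0 < mu A)%E ->
  exists v, [/\ mem v, L1_mem mu v, forall x, 0 <= v x,
    forall x, v x != 0 -> A x & ~ {ae mu, forall x, v x = 0}].
Proof.
move=> sat mA A_gt0; have [D DT mD] := sf.
have [e Me e_gt0] := weak_unit ideal sat sf.
have [n ADn] : exists n, ~ mu.-negligible (A `&` D n).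
  apply/existsNP => AD0; move: A_gt0; rewrite lt0e => /andP[/eqP]; case.
  apply: measure_negligible => //; rewrite -(setIT A) DT setI_bigcupr.
  exact: negligible_bigcup.
have [mDn Dn_fin] := mD n; have mADn := measurableI _ _ mA mDn.
pose v x := Num.min (e x) 1 * \1_(A `&` D n) x.
have min_ge0 x : 0 <= Num.min (e x) 1 by rewrite le_min ltW/=.
have mmin : measurable_fun setT (fun x => Num.min (e x) 1).
  by apply: measurable_minr => //; exact: (solid_measurable ideal).
have mv : measurable_fun setT v by exact: measurable_funM.
exists v; split.
- apply: (solid_mem_le ideal mv Me) => x.
  rewrite normrM -[leRHS]mulr1 ler_pM ?normr_indic_le1//.
  by rewrite !ger0_norm ?ge_min ?lexx// ltW.
- apply: (solid_mem_le (L1_solid_space mu) mv (g := \1_(D n))) => [|x].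
    exact: L1_mem_indic.
  rewrite normrM -[leRHS]mul1r ler_pM//.
    by rewrite ger0_norm// ge_min lexx orbT.
  by rewrite !indicE in_setI !ger0_norm// ler_nat; case: (x \in A).
- by move=> x; rewrite mulr_ge0// indicE.
- move=> x; rewrite mulf_eq0 negb_or => /andP[_].
  by rewrite indicE; case: (boolP (x \in _)) => [/set_mem[]|]; rewrite ?eqxx.
- move=> v0; apply: ADn; apply: negligibleS v0 => x ADx /=; apply/eqP.
  by rewrite /v indicE mem_set// mulr1 gt_eqF// lt_min e_gt0/=.
Qed.

Theorem kdual_saturated : saturated mu mem -> saturated mu (kdual_mem mu mem).
Proof.
move=> sat [A [mA A_gt0 dualA]].
have [v [Mv Lv v_ge0 vA v_neq0]] := exists_mem_L1_nonzero_on sat mA A_gt0.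
have [g Dg] := exists_kdual_nonzero_on Mv Lv v_ge0 v_neq0; apply.
by apply: filterS (dualA _ Dg) => x gA /vA.
Qed.

End KoetheDualSaturated.

(** * Pi-products *)

Section NonnegativeSeries.
Context {R : realType}.

Lemma nneseries_single (a : nat -> \bar R) : (forall n, 0 <= a n)%E ->
  (forall n, a n.+1 = 0%E) -> (\sum_(0 <= n <oo) a n)%E = a 0%N.
Proof.
move=> a_ge0 a0; rewrite nneseries_recl//.
by rewrite (@eseries_cond _ _ xpredT 1) eseries0 ?adde0// => -[|n].
Qed.

Definition interleave {A : Type} (a b : nat -> A) (n : nat) : A :=
  if odd n then b n./2 else a n./2.

Lemma nneseries_interleave (a b : nat -> \bar R) :
  (forall n, 0 <= a n)%E -> (forall n, 0 <= b n)%E ->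
  (\sum_(0 <= n <oo) interleave a b n =
   \sum_(0 <= n <oo) a n + \sum_(0 <= n <oo) b n)%E.
Proof.
move=> a_ge0 b_ge0; have ab_ge0 n : (0 <= interleave a b n)%E.
  by rewrite /interleave; case: ifP.
have partial N : (\sum_(0 <= n < N.*2) interleave a b n =
    \sum_(0 <= n < N) (a n + b n))%E.
  elim: N => [|N IH]; first by rewrite !big_nil.
  rewrite doubleS !big_nat_recr//= IH /interleave /= odd_double /=.
  by rewrite uphalf_double doubleK addeA.
rewrite -nneseriesD//; apply/eqP; rewrite eq_le; apply/andP; split.
  apply: lime_le; first exact: is_cvg_nneseries.
  apply: nearW => N.
  apply: (@le_trans _ _ (\sum_(0 <= n < N.*2) interleave a b n)%E).
    rewrite [leRHS](big_cat_nat (n := N))//=; last by rewrite -addnn leq_addr.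
    by rewrite leeDl// sume_ge0.
  by rewrite partial; apply: nneseries_lim_ge => n _ _; exact: adde_ge0.
apply: lime_le; first by apply: is_cvg_nneseries => n _ _; exact: adde_ge0.
by apply: nearW => N; rewrite -partial; exact: nneseries_lim_ge.
Qed.

End NonnegativeSeries.

Section PiNorm.
Context {d : measure_display} {T : measurableType d} {R : realType}.
Variable mu : {measure set T -> \bar R}.
Variables (memX memY : (T -> R) -> Prop) (nrmX nrmY : (T -> R) -> \bar R).
Hypotheses (solidX : solid_space mu memX nrmX)
  (solidY : solid_space mu memY nrmY).
Local Notation pi_nrm := (pi_norm mu memX nrmX memY nrmY).
Implicit Types (h k y z : T -> R).

Let cost_ge0 y z : memX y -> memY z -> (0 <= nrmX y * nrmY z)%E.
Proof.
move=> Xy Yz.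
by rewrite mule_ge0 ?(solid_norm_ge0 solidX) ?(solid_norm_ge0 solidY).
Qed.

Lemma pi_norm_ge0 h : (0 <= pi_nrm h)%E.
Proof.
apply: le_ereal_inf_tmp => _ [[f g] [/= fg _ _] <-].
by apply: nneseries_ge0 => n _ _; apply: cost_ge0; case: (fg n).
Qed.

Lemma pi_norm_le_cost h (f g : nat -> T -> R) :
  (forall n, memX (f n) /\ memY (g n)) ->
  {ae mu, forall x,
    ((`|h x|)%:E <= \sum_(0 <= n <oo) (`|f n x * g n x|)%:E)%E} ->
  (pi_nrm h <= \sum_(0 <= n <oo) (nrmX (f n) * nrmY (g n)))%E.
Proof.
move=> fg hfg.
have [cost_fin|] := ltP (\sum_(0 <= n <oo) (nrmX (f n) * nrmY (g n)))%E +oo%E.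
  by apply: ereal_inf_lbound; exists (f, g).
by apply: le_trans; exact: leey.
Qed.

Lemma le_pi_norm h k : {ae mu, forall x, `|h x| <= `|k x|} ->
  (pi_nrm h <= pi_nrm k)%E.
Proof.
move=> hk; apply: ereal_inf_le_tmp => _ [fg [fg_mem fg_ge fg_fin] <-].
exists fg => //; split => //; apply: filterS2 hk fg_ge => x hkx.
by apply: le_trans; rewrite lee_fin.
Qed.

Lemma pi_normM y z : memX y -> memY z ->
  (pi_nrm (fun x => (y x * z x)%R) <= nrmX y * nrmY z)%E.
Proof.
move=> Xy Yz.
pose f n := if n is 0%N then y else fun=> 0.
pose g n := if n is 0%N then z else fun=> 0.
have fg n : memX (f n) /\ memY (g n).
  case: n => [|n]; split => //; first exact: (solid_mem0 solidX).
  exact: (solid_mem0 solidY).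
apply: le_trans (pi_norm_le_cost (f := f) (g := g) fg _) _.
  apply: aeW => x; rewrite nneseries_single// => n.
  by rewrite /= mul0r normr0.
rewrite nneseries_single// => n; first by apply: cost_ge0; case: (fg n).
by rewrite /= (solid_norm0 solidX) mul0e.
Qed.

Lemma pi_normD h k : (pi_nrm (fun x => (h x + k x)%R) <= pi_nrm h + pi_nrm k)%E.
Proof.
have [/andP[h_fin k_fin]|] :=
  boolP ((pi_nrm h < +oo) && (pi_nrm k < +oo))%E; last first.
  rewrite negb_and -!leNgt !leye_eq => /orP[/eqP ->|/eqP ->].
    by rewrite addye ?leey// gt_eqF// (lt_le_trans _ (pi_norm_ge0 _)).
  by rewrite addey ?leey// gt_eqF// (lt_le_trans _ (pi_norm_ge0 _)).
rewrite -ge0_fin_numE ?pi_norm_ge0// in h_fin.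
rewrite -ge0_fin_numE ?pi_norm_ge0// in k_fin.
apply/lee_addgt0Pr => e e_gt0; have e2_gt0 : 0 < e / 2 by rewrite divr_gt0.
have [_ [[f1 g1] [/= fg1 h_le _] <-] cost1] :=
  lb_ereal_inf_adherent e2_gt0 h_fin.
have [_ [[f2 g2] [/= fg2 k_le _] <-] cost2] :=
  lb_ereal_inf_adherent e2_gt0 k_fin.
have fg n : memX (interleave f1 f2 n) /\ memY (interleave g1 g2 n).
  by rewrite /interleave; case: ifP.
apply: le_trans (pi_norm_le_cost fg _) _.
  apply: filterS2 h_le k_le => x hx kx.
  rewrite (@eq_eseriesr _ _ (interleave (fun n => (`|f1 n x * g1 n x|)%:E)
      (fun n => (`|f2 n x * g2 n x|)%:E))); last first.
    by move=> n _; rewrite /interleave; case: ifP.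
  rewrite nneseries_interleave//.
  by apply: le_trans (leeD hx kx); rewrite -EFinD lee_fin ler_normD.
rewrite (@eq_eseriesr _ _ (interleave (fun n => nrmX (f1 n) * nrmY (g1 n))%E
    (fun n => nrmX (f2 n) * nrmY (g2 n))%E)); last first.
  by move=> n _; rewrite /interleave; case: ifP.
rewrite nneseries_interleave => [|n|n].
- apply: le_trans (leeD (ltW cost1) (ltW cost2)) _.
  by rewrite addeACA -EFinD -splitr.
- by apply: cost_ge0; case: (fg1 n).
- by apply: cost_ge0; case: (fg2 n).
Qed.

Lemma pi_normZ_le a h : (pi_nrm (fun x => (a * h x)%R) <= `|a|%:E * pi_nrm h)%E.
Proof.
have [->|a_neq0] := eqVneq a 0.
  have := pi_normM (solid_mem0 solidX) (solid_mem0 solidY).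
  rewrite (solid_norm0 solidX) normr0 !mul0e; apply: le_trans.
  by apply: le_pi_norm; apply: aeW => x; rewrite !mul0r.
rewrite -lee_pdivrMl ?normr_gt0//; apply: le_ereal_inf_tmp.
move=> _ [[f g] [/= fg h_le _] <-]; rewrite lee_pdivrMl ?normr_gt0//.
have afg n : memX (fun x => a * f n x) /\ memY (g n).
  by case: (fg n) => Xf Yg; split => //; exact: (solid_memZ solidX).
apply: le_trans (pi_norm_le_cost afg _) _.
  apply: filterS h_le => x hx; rewrite normrM EFinM.
  apply: le_trans (lee_wpmul2l _ hx) _ => //.
  rewrite -nneseriesZl//; apply: lee_nneseries => [n _ _|n _] //.
  by rewrite -EFinM lee_fin -mulrA [leRHS]normrM.
rewrite -nneseriesZl; last by move=> n _; apply: cost_ge0; case: (fg n).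
apply: lee_nneseries => [n _ _|n _]; first by apply: cost_ge0; case: (afg n).
by rewrite (solid_normZ solidX) ?muleA//; case: (fg n).
Qed.

Definition pi_space : set (T -> R) :=
  [set h | measurable_fun setT h /\ (pi_nrm h < +oo)%E].

Lemma pi_spaceM y z : memX y -> memY z -> pi_space (fun x => y x * z x).
Proof.
move=> Xy Yz; split.
  apply: measurable_funM; first exact: (solid_measurable solidX).
  exact: (solid_measurable solidY).
apply: le_lt_trans (pi_normM Xy Yz) _.
rewrite -ge0_fin_numE ?cost_ge0//.
by rewrite fin_numM ?(solid_fin_num solidX) ?(solid_fin_num solidY).
Qed.

Lemma pi_solid_space : solid_space mu pi_space pi_nrm.
Proof.
split.
- by move=> h [].
- split.
  + have := pi_spaceM (solid_mem0 solidX) (solid_mem0 solidY).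
    by under eq_fun do rewrite mul0r.
  + move=> h k [mh h_fin] [mk k_fin]; split; first exact: measurable_funD.
    by apply: le_lt_trans (pi_normD _ _) _; rewrite lte_add_pinfty.
  + move=> a h [mh h_fin]; split; first exact: measurable_funM.
    by apply: le_lt_trans (pi_normZ_le _ _) _; rewrite lte_mul_pinfty.
- by move=> h [_ h_fin]; rewrite ge0_fin_numE// pi_norm_ge0.
- by move=> h _; exact: pi_norm_ge0.
- by move=> h k _ _; exact: pi_normD.
- by move=> a h _; exact: pi_normZ_le.
- move=> h k mh [_ k_fin] hk; split; last exact: le_pi_norm.
  by split => //; apply: le_lt_trans (le_pi_norm hk) k_fin.
Qed.

Lemma L1_norm_le_pi_norm (w h : T -> R) (C : R) : 0 < C ->
  measurable_fun setT w -> measurable_fun setT h ->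
  (forall y z, memX y -> memY z ->
    (L1_norm mu (fun x => w x * (y x * z x))%R <=
     C%:E * (nrmX y * nrmY z))%E) ->
  (L1_norm mu (fun x => w x * h x)%R <= C%:E * pi_nrm h)%E.
Proof.
move=> C_gt0 mw mh wC; rewrite -lee_pdivrMl//; apply: le_ereal_inf_tmp.
move=> _ [[f g] [/= fg h_le _] <-]; rewrite lee_pdivrMl//.
pose wfg n x := w x * (f n x * g n x).
have mwfg n : measurable_fun setT (wfg n).
  by apply: measurable_funM => //; case: (pi_spaceM (fg n).1 (fg n).2).
apply: (@le_trans _ _ (\sum_(0 <= n <oo) L1_norm mu (wfg n))%E).
  rewrite -integral_abs_eseries//; apply: ae_ge0_le_integral => //.
  - exact/measurable_EFin_normr/measurable_funM.
  - by move=> x _; exact: abs_eseries_ge0.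
  - exact: measurable_abs_eseries.
  - apply: filterS h_le => x hx _; rewrite normrM EFinM.
    apply: le_trans (lee_wpmul2l _ hx) _ => //.
    rewrite -nneseriesZl//; apply: lee_nneseries => [n _ _|n _] //.
    by rewrite -EFinM lee_fin [leRHS]normrM.
rewrite -nneseriesZl; last by move=> n _; apply: cost_ge0; case: (fg n).
apply: lee_nneseries => [n _ _|n _]; first exact: L1_norm_ge0.
by apply: wC; case: (fg n).
Qed.

Lemma pi_normM_abs_continuousl y z : memX y -> memY z ->
  abs_continuous_norm nrmX y -> abs_continuous_norm pi_nrm (fun x => y x * z x).
Proof.
move=> Xy Yz acy A mA nA A0.
have bound_cvg0 :
    (nrmX (fun x => (\1_(A n) x * y x)%R) * nrmY z)%E @[n --> \oo] --> 0%E.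
  rewrite -(mul0e (nrmY z)); apply: cvgeZr; last exact: acy.
  exact: (solid_fin_num solidY).
apply: (squeeze_cvge _ (cvg_cst 0%E) bound_cvg0); apply: nearW => n.
rewrite pi_norm_ge0/=; under eq_fun do rewrite mulrA.
apply: pi_normM => //; apply: (solid_mem_mul_le1 solidX) => //.
exact: normr_indic_le1.
Qed.

Lemma pi_normM_abs_continuousr y z : memX y -> memY z ->
  abs_continuous_norm nrmY z -> abs_continuous_norm pi_nrm (fun x => y x * z x).
Proof.
move=> Xy Yz acz A mA nA A0.
have bound_cvg0 :
    (nrmX y * nrmY (fun x => (\1_(A n) x * z x)%R))%E @[n --> \oo] --> 0%E.
  rewrite -(mule0 (nrmX y)); apply: cvgeZl; last exact: acz.
  exact: (solid_fin_num solidX).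
apply: (squeeze_cvge _ (cvg_cst 0%E) bound_cvg0); apply: nearW => n.
rewrite pi_norm_ge0/=; under eq_fun do rewrite mulrCA.
apply: pi_normM => //; apply: (solid_mem_mul_le1 solidY) => //.
exact: normr_indic_le1.
Qed.

End PiNorm.

Section PiDual.
Context {d : measure_display} {T : measurableType d} {R : realType}.
Variable mu : {measure set T -> \bar R}.

Lemma sigma_oc_abs_continuous mem nrm (y : T -> R) : solid_space mu mem nrm ->
  sigma_oc mu mem nrm -> mem y -> abs_continuous_norm nrm y.
Proof.
move=> solid oc My A mA nA A0.
have indic_mem n : mem (fun x => \1_(A n) x * y x).
  by apply: (solid_mem_mul_le1 solid) => //; exact: normr_indic_le1.
under eq_fun do rewrite -(solid_norm_normr solid (indic_mem _)).
apply: oc => [n|]; first exact: (solid_mem_normr solid).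
apply: aeW => x; split=> [n|].
  rewrite !normrM ler_wpM2r// !indicE !ger0_norm// ler_nat.
  have [/set_mem xA|//] := boolP (x \in A n.+1).
  by rewrite mem_set//; move/subsetPset: (nA _ _ (leqnSn n)); exact.
apply: cvg_near_cst; apply: filterS (bigcap0_near x nA A0) => n Anx.
by rewrite indicE memNset// mul0r normr0.
Qed.

Variables (memX memY : (T -> R) -> Prop) (nrmX nrmY : (T -> R) -> \bar R).
Hypotheses (idealX : ideal_space mu memX nrmX)
  (idealY : ideal_space mu memY nrmY).
Local Notation pi_nrm := (pi_norm mu memX nrmX memY nrmY).
Local Notation pi_mem := (pi_space mu memX memY nrmX nrmY).

Theorem pi_dual_representation (F : (T -> R) -> R) (C : R) :
  sigma_finite setT mu -> saturated mu memX -> saturated mu memY ->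
  sigma_oc mu memX nrmX \/ sigma_oc mu memY nrmY ->
  linear_on pi_mem F -> 0 <= C ->
  (forall f, pi_mem f -> F f <= C * fine (pi_nrm f)) ->
  exists2 g : T -> R, measurable_fun setT g &
    forall y z, memX y -> memY z ->
      L1_mem mu (fun x => g x * (y x * z x)) /\
      \int[mu]_x (g x * (y x * z x)) = F (fun x => y x * z x).
Proof.
move=> sf satX satY oc linF C_ge0 F_le.
have solidP := pi_solid_space idealX idealY.
have ac y z : memX y -> memY z ->
    abs_continuous_norm pi_nrm (fun x => y x * z x).
  move=> Xy Yz; case: oc => oc.
    apply: (pi_normM_abs_continuousl idealX idealY Xy Yz).
    exact: (sigma_oc_abs_continuous idealX oc Xy).
  apply: (pi_normM_abs_continuousr idealX idealY Xy Yz).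
  exact: (sigma_oc_abs_continuous idealY oc Yz).
have [e Xe e_gt0] := weak_unit idealX satX sf.
have [e' Ye' e'_gt0] := weak_unit idealY satY sf.
have [|g mg gF] := representation_abs_continuous solidP linF C_ge0 F_le sf
  (pi_spaceM idealX idealY Xe Ye') _ (ac _ _ Xe Ye').
  by move=> x; rewrite mulr_gt0.
exists g => // y z Xy Yz; apply: gF; last exact: ac.
exact: (pi_spaceM idealX idealY).
Qed.

End PiDual.

(** * Factorization of sequences *)

Section FiniteCombinations.
Context {R : realType}.

Lemma seq_combination_matrix (s : seq (R * (nat * nat))) :
  exists (n : nat) (r : nat -> nat -> R),
    (forall i j, `|r i j| <= \sum_(k <- s) `|k.1|) /\
    forall (V : lmodType R) (x : nat * nat -> V),
      \sum_(k <- s) k.1 *: x k.2 =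
      \sum_(i < n) \sum_(j < n) r i j *: x (i : nat, j : nat).
Proof.
pose n := (\sum_(k <- s) (k.2.1 + k.2.2)).+1.
pose r i j := \sum_(k <- s) if k.2 == (i, j) then k.1 else 0.
exists n, r; split=> [i j|V x].
  apply: le_trans (ler_norm_sum _ _ _) _; apply: ler_sum => k _.
  by case: ifP; rewrite ?normr0.
have n_gt k : k \in s -> (k.2.1 < n)%N /\ (k.2.2 < n)%N.
  move=> ks; have kn : (k.2.1 + k.2.2 < n)%N.
    by rewrite ltnS (big_rem k ks) leq_addr.
  by split; apply: leq_ltn_trans kn; rewrite ?leq_addr ?leq_addl.
rewrite pair_big/=; under [RHS]eq_bigr do rewrite scaler_suml.
rewrite exchange_big/=; apply: eq_big_seq => -[c [i j]] /n_gt/= [i_lt j_lt].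
rewrite (bigD1 (Ordinal i_lt, Ordinal j_lt))//= eqxx big1 ?addr0//.
move=> -[i' j'] ij'.
case: ifPn => [/eqP[ii' jj']|_]; last by rewrite scale0r.
by case/eqP: ij'; congr pair; exact: val_inj.
Qed.

Lemma sum_normr_disjoint n (a : nat -> R) :
  (forall i j, i <> j -> a i = 0 \/ a j = 0) ->
  \sum_(i < n) `|a i| = `|\sum_(i < n) a i|.
Proof.
move=> disj; elim: n => [|n IH]; first by rewrite !big_ord0 normr0.
rewrite !big_ord_recr /= IH; have [->|an0] := eqVneq (a n) 0.
  by rewrite normr0 !addr0.
suff -> : \sum_(i < n) a i = 0 by rewrite normr0 !add0r.
apply: big1 => i _; have [|//|an] := disj i n.
  by move=> i_n; have := ltn_ord i; rewrite i_n ltnn.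
by rewrite an eqxx in an0.
Qed.

End FiniteCombinations.

Section FiniteSumsOfIntegrals.
Context {d : measure_display} {T : measurableType d} {R : realType}.
Variable mu : {measure set T -> \bar R}.

Lemma Rintegral_sum (I : Type) (s : seq I) (f : I -> T -> R) :
  (forall i, L1_mem mu (f i)) ->
  \int[mu]_x (\sum_(i <- s) f i x) = \sum_(i <- s) \int[mu]_x f i x.
Proof.
move=> Lf; have subL1 := solid_subspace (L1_solid_space mu).
by rewrite -(linear_on_sum s subL1 (linear_on_Rintegral mu) Lf) fct_sumE.
Qed.

Lemma sum_scale_integral (I : Type) (s : seq I) (r : I -> R) (f : I -> T -> R) :
  (forall i, L1_mem mu (f i)) ->
  (\sum_(i <- s) (r i)%:E * \int[mu]_x (f i x)%:E)%E =
  (\int[mu]_x (\sum_(i <- s) r i * f i x))%:E.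
Proof.
move=> Lf; have Lrf i := solid_memZ (L1_solid_space mu) (r i) (Lf i).
rewrite Rintegral_sum// -sumEFin; apply: eq_bigr => i _.
rewrite RintegralZl//; last exact: Lf.
by rewrite EFinM EFin_Rintegral.
Qed.

End FiniteSumsOfIntegrals.

Section KoetheDualAnnihilators.
Context {d : measure_display} {T : measurableType d} {R : realType}.
Variable mu : {measure set T -> \bar R}.
Variables (mem : (T -> R) -> Prop) (nrm : (T -> R) -> \bar R).
Hypothesis ideal : ideal_space mu mem nrm.
Implicit Types w z : T -> R.

Lemma kdual_eq0_ae w : sigma_finite setT mu -> saturated mu mem ->
  kdual_mem mu mem w -> (forall z, mem z -> \int[mu]_x (w x * z x) = 0) ->
  {ae mu, forall x, w x = 0}.
Proof.
move=> sf sat Dw w_annihilates; have mw := kdual_mem_measurable Dw.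
have [e Me e_gt0] := weak_unit ideal sat sf.
have Msg : mem (fun x => Num.sg (w x) * e x).
  apply: (solid_mem_mul_le1 ideal) => //; first exact: measurable_fun_sg.
  by move=> x; exact: normr_sg_le1.
have sgE x : w x * (Num.sg (w x) * e x) = `|w x| * e x.
  by rewrite normrEsg mulrA [w x * _]mulrC.
have Lwe := Dw.2 _ Msg.
have /(ae_eq_integral_abs mu measurableT (measurable_int _ Lwe)) :
    (\int[mu]_x `|(w x * (Num.sg (w x) * e x))%:E| = 0)%E.
  rewrite -[RHS](congr1 EFin (w_annihilates _ Msg)) EFin_Rintegral//.
  apply: eq_integral => x _; rewrite sgE gee0_abs// lee_fin.
  by rewrite mulr_ge0// ltW.
apply: filterS => x /(_ Logic.I) /= [].
rewrite sgE => /eqP; rewrite mulf_eq0 normr_eq0 (gt_eqF (e_gt0 x)) orbF.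
by move/eqP.
Qed.

Lemma kdual_annihilates_basis (b : nat -> T -> R) w z :
  schauder_basis mem nrm b -> kdual_mem mu mem w ->
  (forall i, \int[mu]_x (w x * b i x) = 0) -> mem z ->
  \int[mu]_x (w x * z x) = 0.
Proof.
move=> [Mb basis] Dw wb Mz; have [a [cvg_a _]] := basis z Mz.
pose s N x := \sum_(k < N) a k * b k x.
have Ms N : mem (s N) by exact: (solid_mem_lincomb ideal).
have ws N : \int[mu]_x (w x * s N x) = 0.
  under eq_Rintegral do rewrite mulr_sumr.
  rewrite Rintegral_sum => [|k]; last exact/Dw.2/(solid_memZ ideal).
  apply: big1 => k _; under eq_Rintegral do rewrite mulrCA.
  by rewrite RintegralZl ?wb ?mulr0//; exact: Dw.2.
have bound_cvg0 : (kdual_norm mu mem nrm w * nrm (fun x => (z x - s N x)%R))%E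
    @[N --> \oo] --> 0%E.
  rewrite -(mule0 (kdual_norm mu mem nrm w)); apply: cvgeZl => //.
  exact: (kdual_norm_fin_num ideal).
apply/eqP; rewrite -normr_le0 -lee_fin; apply: (cvge_to_ge bound_cvg0).
apply: nearW => N.
have Mzs : mem (fun x => z x - s N x) by exact: (solid_memB ideal).
apply: le_trans (hoelder_kdual ideal Dw Mzs).
rewrite -[X in `|X|]subr0 -(ws N) -RintegralB//; [|exact: Dw.2..].
under eq_Rintegral do rewrite -mulrBr.
by apply: normr_Rintegral_le_L1_norm; exact: Dw.2.
Qed.

End KoetheDualAnnihilators.

Section SequenceFactorization.
Context {d : measure_display} {T : measurableType d} {R : realType}.
Variable mu : {measure set T -> \bar R}.
Variables (memY memW : (T -> R) -> Prop) (nrmY nrmW : (T -> R) -> \bar R).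
Hypotheses (idealY : ideal_space mu memY nrmY)
  (idealW : ideal_space mu memW nrmW).
Hypotheses (sf : sigma_finite setT mu) (satY : saturated mu memY)
  (satW : saturated mu memW).
Local Notation pi_nrm := (pi_norm mu memY nrmY memW nrmW).
Local Notation multiplier := (mulsp_mem memY (kdual_mem mu memW)).

Lemma multiplier_L1 g y z : multiplier g -> memY y -> memW z ->
  L1_mem mu (fun x => g x * (y x * z x)).
Proof.
by move=> [_ gY] Yy Wz; under eq_fun do rewrite mulrA; exact: (gY _ Yy).2.
Qed.

Lemma multiplier_bounded g : multiplier g -> exists2 C : R, 0 < C &
  forall h, measurable_fun setT h ->
    (L1_norm mu (fun x => (g x * h x)%R) <= C%:E * pi_nrm h)%E.
Proof.
move=> Mg.
have [C C_gt0 gC] := mulsp_bounded idealY (kdual_solid_space idealW) Mg.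
exists C => // h mh; apply: (L1_norm_le_pi_norm idealY idealW C_gt0 Mg.1 mh).
move=> y z Yy Wz; under eq_fun do rewrite mulrA.
apply: le_trans (hoelder_kdual idealW (Mg.2 _ Yy) Wz) _; rewrite muleA.
by apply: lee_wpmul2r; [exact: (solid_norm_ge0 idealW)|exact: gC].
Qed.

Lemma pi_domination_seq (y z : nat -> T -> R) (t : nat -> nat -> R) (C : R) :
  (forall j, memY (y j)) -> (forall i, memW (z i)) ->
  (forall n m (r : nat -> nat -> R), (forall i j, `|r i j| <= 1) ->
    ((\sum_(i < n) \sum_(j < m) r i j * t i j)%R%:E <= C%:E *
      pi_nrm (fun x => \sum_(i < n) \sum_(j < m) r i j * y j x * z i x)%R)%E) ->
  forall s : seq (R * (nat * nat)),
    \sum_(k <- s) k.1 * t k.2.1 k.2.2 <= C * fine (pi_nrm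
      (\sum_(k <- s) k.1 *: (fun x => y k.2.2 x * z k.2.1 x))).
Proof.
move=> Yy Wz tC s; have solidP := pi_solid_space idealY idealW.
have [n [r [r_le rE]]] := seq_combination_matrix s.
pose c := 1 + \sum_(k <- s) `|k.1|.
have c_gt0 : 0 < c by rewrite ltr_pwDl// sumr_ge0.
have r1 i j : `|c^-1 * r i j| <= 1.
  rewrite normrM gtr0_norm ?invr_gt0// ler_pdivrMl// mulr1.
  by apply: le_trans (r_le i j) _; rewrite lerDr.
have tE := rE R^o (fun ij => t ij.1 ij.2).
pose yz (ij : nat * nat) x := y ij.2 x * z ij.1 x.
pose h : T -> R := \sum_(k <- s) k.1 *: yz k.2.
have hE x :
    \sum_(i < n) \sum_(j < n) c^-1 * r i j * y j x * z i x = c^-1 * h x.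
  rewrite /h rE fct_sumE mulr_sumr; apply: eq_bigr => i _.
  rewrite fct_sumE mulr_sumr; apply: eq_bigr => j _.
  by rewrite /= -!mulrA.
have Zh : pi_space mu memY memW nrmY nrmW h.
  apply: (linear_subspace_sum _ (solid_subspace solidP)) => k.
  have [_ _ ZZ] := solid_subspace solidP.
  exact/ZZ/(pi_spaceM idealY idealW).
have := tC n n _ r1; under [in pi_nrm _]eq_fun do rewrite hE.
under eq_bigr do under eq_bigr do rewrite -mulrA.
under eq_bigr do rewrite -mulr_sumr.
rewrite -mulr_sumr (solid_normZ solidP)// gtr0_norm ?invr_gt0//.
rewrite -(fineK (solid_fin_num solidP Zh)) -!EFinM lee_fin mulrCA.
by rewrite ler_pM2l ?invr_gt0// -tE.
Qed.

Lemma pi_interpolation (y z : nat -> T -> R) (t : nat -> nat -> R) (C : R) :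
  (forall j, memY (y j)) -> (forall i, memW (z i)) ->
  sigma_oc mu memY nrmY \/ sigma_oc mu memW nrmW -> 0 <= C ->
  (forall n m (r : nat -> nat -> R), (forall i j, `|r i j| <= 1) ->
    ((\sum_(i < n) \sum_(j < m) r i j * t i j)%R%:E <= C%:E *
      pi_nrm (fun x => \sum_(i < n) \sum_(j < m) r i j * y j x * z i x)%R)%E) ->
  exists g, multiplier g /\
    forall i j, \int[mu]_x (g x * (y j x * z i x)) = t i j.
Proof.
move=> Yy Wz oc C_ge0 tC; have solidP := pi_solid_space idealY idealW.
pose yz (ij : nat * nat) x := y ij.2 x * z ij.1 x.
have Zyz ij : pi_space mu memY memW nrmY nrmW (yz ij).
  exact: (pi_spaceM idealY idealW).
have [F [linF F_le Ft]] := mazur_orlicz_interpolation (solid_subspace solidP)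
  (x := yz) (t := fun ij => t ij.1 ij.2)
  (solid_norm_sublinear solidP C_ge0) Zyz (pi_domination_seq Yy Wz tC).
have [g mg gF] :=
  pi_dual_representation idealY idealW sf satY satW oc linF C_ge0 F_le.
exists g; split.
  split=> // u Yu; split=> [|v Wv].
    by apply: measurable_funM => //; exact: (solid_measurable idealY).
  by under eq_fun do rewrite -mulrA; case: (gF _ _ Yu Wv).
by move=> i j; rewrite (gF _ _ (Yy j) (Wz i)).2; exact: (Ft (i, j)).
Qed.

Variables a b c : nat -> T -> R.
Hypotheses (Wa : forall j, kdual_mem mu memW (a j)) (Yb : forall j, memY (b j)).
Hypothesis (Wc : forall i, memW (c i)).

Definition factors_through_multiplier := exists g, multiplier g /\
  forall j, {ae mu, forall x, a j x = g x * b j x}.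

Definition pi_dominated := exists C : R, 0 < C /\
  forall (n m : nat) (r : nat -> nat -> R), (forall i j, `|r i j| <= 1) ->
  (\sum_(i < n) \sum_(j < m) (r i j)%:E * \int[mu]_x (a j x * c i x)%R%:E <=
   C%:E *
     pi_nrm (fun x => (\sum_(i < n) \sum_(j < m) r i j * b j x * c i x)%R))%E.

Definition L1_dominated := exists C : R, 0 < C /\
  forall (n m : nat) (r : nat -> R), (forall j, `|r j| <= 1) ->
  (\sum_(j < m) (r j)%:E * \int[mu]_x (a j x * c n x)%R%:E <=
   C%:E * \int[mu]_x (`|\sum_(j < m) r j * b j x * c n x|%R)%:E)%E.

Let measurable_row (r : nat -> R) m i :
  measurable_fun setT (fun x => \sum_(j < m) r j * b j x * c i x).
Proof.
apply: measurable_sum => j; apply: measurable_funM.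
  by apply: measurable_funM => //; exact: (solid_measurable idealY).
exact: (solid_measurable idealW).
Qed.

Lemma factorization_row g (r : nat -> R) m i : multiplier g ->
  (forall j, {ae mu, forall x, a j x = g x * b j x}) ->
  L1_mem mu (fun x => g x * \sum_(j < m) r j * b j x * c i x) /\
  (\sum_(j < m) (r j)%:E * \int[mu]_x (a j x * c i x)%R%:E)%E =
  (\int[mu]_x (g x * \sum_(j < m) r j * b j x * c i x))%:E.
Proof.
move=> Mg ag; have Lg j := multiplier_L1 Mg (Yb j) (Wc i).
have rowE x : g x * \sum_(j < m) r j * b j x * c i x =
    \sum_(j < m) r j * (g x * (b j x * c i x)).
  by rewrite mulr_sumr; apply: eq_bigr => j _; ring.
split.
  under eq_fun do rewrite rowE.
  apply: (solid_mem_sum (L1_solid_space mu) _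
    (F := fun j x => r (val j) * (g x * (b (val j) x * c i x)))) => j.
  exact: (solid_memZ (L1_solid_space mu)).
under eq_Rintegral do rewrite rowE.
rewrite -(sum_scale_integral _ (fun j => r (val j)) (fun j => Lg (val j))).
apply: eq_bigr => j _; congr (_ * _)%E; apply: ae_eq_integral => //.
- exact: measurable_int ((Wa j).2 _ (Wc i)).
- exact: measurable_int (Lg j).
- by apply: filterS (ag j) => x -> _; rewrite mulrA.
Qed.

Lemma factors_pi_dominated : factors_through_multiplier -> pi_dominated.
Proof.
move=> [g [Mg ag]]; have [C C_gt0 gC] := multiplier_bounded Mg.
exists C; split => // n m r _.
under eq_bigr do rewrite (factorization_row (r _) m _ Mg ag).2.
have Lrow i := (factorization_row (r i) m i Mg ag).1.
rewrite sumEFin -(Rintegral_sum _ (fun i : 'I_n => Lrow i)).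
have mh : measurable_fun setT
    (fun x => \sum_(i < n) \sum_(j < m) r i j * b j x * c i x).
  by apply: measurable_sum => i; exact: measurable_row.
apply: le_trans (gC _ mh); under eq_Rintegral do rewrite -mulr_sumr.
apply: Rintegral_le_L1_norm; under eq_fun do rewrite mulr_sumr.
apply: (solid_mem_sum (L1_solid_space mu) _
  (F := fun i x => g x * \sum_(j < m) r (val i) j * b j x * c (val i) x)) => i.
exact: (factorization_row _ _ _ Mg ag).1.
Qed.

Lemma pi_dominated_factors : schauder_basis memW nrmW c ->
  sigma_oc mu memY nrmY \/ sigma_oc mu memW nrmW ->
  pi_dominated -> factors_through_multiplier.
Proof.
move=> basis oc [C [C_gt0 aC]].
have Lac i j : L1_mem mu (fun x => a j x * c i x) := (Wa j).2 _ (Wc i).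
have [|g [Mg gt]] := @pi_interpolation b c
    (fun i j => \int[mu]_x (a j x * c i x)) C Yb Wc oc (ltW C_gt0).
  move=> n m r r1; apply: le_trans (aC n m r r1); rewrite -sumEFin le_eqVlt.
  apply/orP; left; apply/eqP; apply: eq_bigr => i _.
  rewrite -sumEFin; apply: eq_bigr => j _.
  by rewrite EFinM EFin_Rintegral.
exists g; split => // j.
have solidW' := kdual_solid_space idealW.
have diff0 : {ae mu, forall x, a j x - g x * b j x = 0}.
  have Dab := solid_memB solidW' (Wa j) (Mg.2 _ (Yb j)).
  apply: (kdual_eq0_ae idealW sf satW Dab) => z Wz.
  apply: (kdual_annihilates_basis idealW basis Dab _ Wz) => i.
  under eq_Rintegral do rewrite mulrBl -mulrA.
  by rewrite RintegralB ?gt ?subrr//; [exact: Lac|exact: multiplier_L1].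
by apply: filterS diff0 => x /eqP; rewrite subr_eq0 => /eqP.
Qed.

Lemma L1_dominated_pi_dominated : (forall y, memY y -> kdual_mem mu memW y) ->
  (forall i j, i <> j -> {ae mu, forall x, c i x = 0 \/ c j x = 0}) ->
  L1_dominated -> pi_dominated.
Proof.
move=> YW disj [C [C_gt0 aC]].
have M1 : multiplier (fun=> 1).
  by split=> // y Yy; under eq_fun do rewrite mul1r; exact: YW.
have [K K_gt0 oneK] := multiplier_bounded M1.
exists (C * K); split=> [|n m r r1]; first exact: mulr_gt0.
pose row i x := \sum_(j < m) r i j * b j x * c i x.
have mrow i : measurable_fun setT (row i) by exact: measurable_row.
apply: (@le_trans _ _ (\sum_(i < n) C%:E * L1_norm mu (row i))%E).
  by apply: lee_sum => i _; exact: aC.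
rewrite -ge0_sume_distrr => [|i _]; last exact: L1_norm_ge0.
rewrite EFinM -muleA lee_pmul2l// -ge0_integral_sum//; last first.
  by move=> i; exact: measurable_EFin_normr.
have msum : measurable_fun setT (fun x => \sum_(i < n) row i x).
  exact: measurable_sum.
apply: le_trans (oneK _ msum).
rewrite /L1_norm le_eqVlt; apply/orP; left; apply/eqP.
have disj_ae : {ae mu, forall x, forall i j, i <> j -> c i x = 0 \/ c j x = 0}.
  apply: ae_foralln => i; apply: ae_foralln => j.
  have [->|ij] := pselect (i = j); first by apply: aeW.
  by apply: filterS (disj i j ij).
apply: ae_eq_integral => //.
- under eq_fun do rewrite sumEFin; apply/measurable_EFinP.
  by apply: measurable_sum => i; exact: measurable_fun_normr.
- by apply: measurable_EFin_normr; exact: measurable_funM.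
apply: filterS disj_ae => x cx _; rewrite sumEFin mul1r; congr EFin.
apply: (sum_normr_disjoint n (a := row ^~ x)) => i j /cx[cx0|cx0]; [left|right];
  by apply: big1 => k _; rewrite cx0 mulr0.
Qed.

Lemma factors_L1_dominated : (forall g, multiplier g -> Linf_mem mu g) ->
  factors_through_multiplier -> L1_dominated.
Proof.
move=> MLinf [g [Mg ag]]; have [mg [B gB]] := MLinf g Mg.
have B_gt0 : 0 < `|B| + 1 by rewrite ltr_wpDl.
exists (`|B| + 1); split=> // n m r _.
have [Lrow ->] := factorization_row r m n Mg ag.
apply: le_trans (Rintegral_le_L1_norm Lrow) _.
have mrow := measurable_row r m n.
rewrite -[X in (X%:E * _)%E](gtr0_norm B_gt0).
rewrite -[X in (_ <= _ * X)%E]/(L1_norm _ _) -L1_normZ//.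
have mgrow := L1_mem_measurable Lrow.
apply: le_L1_norm => //; first exact: measurable_funM.
apply: filterS gB => x gx; rewrite !normrM ler_wpM2r// (gtr0_norm B_gt0).
by apply: le_trans gx (le_trans (ler_norm B) _); rewrite lerDl.
Qed.

End SequenceFactorization.

(** * Factorization of operators *)

Lemma schauder_basis_geometric {d} {T : measurableType d} {R : realType}
    mem nrm (b : nat -> T -> R) f :
  schauder_basis mem nrm b -> mem f ->
  exists (a : nat -> R) (N : nat -> nat), forall n,
    (nrm (fun x => (f x - \sum_(k < N n) a k * b k x)%R) <= (4^-1 ^+ n)%:E)%E.
Proof.
move=> [_ basis] Mf; have [a [cvg_a _]] := basis f Mf.
have /choice[N NP] n : exists N,
    (nrm (fun x => (f x - \sum_(k < N) a k * b k x)%R) <= (4^-1 ^+ n)%:E)%E.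
  have e_gt0 : (0 < (4^-1 ^+ n : R)%:E)%E.
    by rewrite lte_fin exprn_gt0// invr_gt0.
  have [N _ /(_ N (leqnn N))/ltW] := cvg_a _ (open_ereal_lt' e_gt0).
  by exists N.
by exists a, N.
Qed.

Section Operators.
Context {R : realType}.
Context {d1 : measure_display} {Om : measurableType d1}.
Context {d2 : measure_display} {De : measurableType d2}.
Variables (mu : {measure set Om -> \bar R}) (nu : {measure set De -> \bar R}).

Lemma bdd_linop_mulsp (X1 X2 : BFS mu) (Y : BFS nu) S (h : Om -> R) :
  bdd_linop X2 Y S -> mulsp_mem (bfs_mem X1) (bfs_mem X2) h ->
  bdd_linop X1 Y (fun f => S (fun x => h x * f x)).
Proof.
move=> [SY Sae Slin [K SK]] hM; have [_ hX] := hM.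
have [C _ hC] := mulsp_bounded (bfs_ideal_space X1) (bfs_solid_space X2) hM.
split=> [f Xf|f g Xf Xg fg|a b f g Xf Xg|].
- exact/SY/hX.
- by apply: Sae; [exact: hX..|apply: filterS fg => x ->].
- under [in S _]eq_fun do rewrite mulrDr mulrCA [h _ * (b * _)]mulrCA.
  by apply: Slin; exact: hX.
exists (`|K| * C) => f Xf; apply: le_trans (SK _ (hX _ Xf)) _.
apply: (@le_trans _ _ (`|K| * bfs_norm X2 (fun x => h x * f x))).
  by rewrite ler_wpM2r ?ler_norm// bfs_norm_ge0//; exact: hX.
by rewrite -mulrA ler_wpM2l//; have := hC _ Xf; rewrite -EFinM lee_fin.
Qed.

Lemma bdd_linop_sub_sum (X : BFS mu) (Y : BFS nu) T f (a : nat -> R)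
    (b : nat -> Om -> R) N :
  bdd_linop X Y T -> bfs_mem X f -> (forall k, bfs_mem X (b k)) ->
  {ae nu, forall y, T (fun x => f x - \sum_(k < N) a k * b k x) y =
    T f y - \sum_(k < N) a k * T (b k) y}.
Proof.
move=> [_ _ Tlin _] Xf Xb; have solidX := bfs_solid_space X.
have Xs n : bfs_mem X (fun x => f x - \sum_(k < n) a k * b k x).
  by apply: (solid_memB solidX) => //; exact: (solid_mem_lincomb solidX).
elim: N => [|N IH].
  apply: aeW => y; rewrite big_ord0 subr0; congr (T _ _).
  by apply/funext => x; rewrite big_ord0 subr0.
rewrite (_ : (fun x => _) =
    fun x => 1 * (f x - \sum_(k < N) a k * b k x) + (- a N) * b N x).
  have := Tlin 1 (- a N) _ _ (Xs N) (Xb N); apply: filterS2 IH => y IHy ->.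
  by rewrite IHy big_ord_recr /=; ring.
by apply/funext => x; rewrite big_ord_recr /=; ring.
Qed.

Lemma bdd_linop_cvg0_ae (X : BFS mu) (Y : BFS nu) T (u : nat -> Om -> R) :
  bdd_linop X Y T -> (forall n, bfs_mem X (u n)) ->
  (forall n, bfs_norm X (u n) <= 4^-1 ^+ n) ->
  {ae nu, forall y, T (u n) y @[n --> \oo] --> 0}.
Proof.
move=> [TY _ _ [K TK]] Xu u_le; have K_gt0 : 0 < `|K| + 1 by rewrite ltr_wpDl.
apply: (ideal_cvg0_ae (bfs_ideal_space Y) K_gt0) => n; first exact: TY.
rewrite lee_fin; apply: le_trans (TK _ (Xu n)) _.
apply: (@le_trans _ _ ((`|K| + 1) * bfs_norm X (u n))); last first.
  by rewrite ler_wpM2l// ltW.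
by rewrite ler_wpM2r ?bfs_norm_ge0// (le_trans (ler_norm K))// lerDl.
Qed.

(* Along a subsequence the partial sums converge a.e. under both operators. *)
Lemma factorization_on_basis (X : BFS mu) (Y1 Y2 : BFS nu) T S
    (b : nat -> Om -> R) (g : De -> R) :
  bdd_linop X Y1 T -> bdd_linop X Y2 S ->
  schauder_basis (bfs_mem X) (bfs_enorm X) b ->
  (forall n, {ae nu, forall y, T (b n) y = g y * S (b n) y}) ->
  forall f, bfs_mem X f -> {ae nu, forall y, T f y = g y * S f y}.
Proof.
move=> hT hS basis Tb f Xf; have [Xb _] := basis.
have solidX := bfs_solid_space X.
have [a [N remainder_le]] := schauder_basis_geometric basis Xf.
pose u n x := f x - \sum_(k < N n) a k * b k x.
have Xu n : bfs_mem X (u n).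
  by apply: (solid_memB solidX) => //; exact: (solid_mem_lincomb solidX).
have Tu := ae_foralln (fun n => bdd_linop_sub_sum a (N n) hT Xf Xb).
have Su := ae_foralln (fun n => bdd_linop_sub_sum a (N n) hS Xf Xb).
have Tu0 := bdd_linop_cvg0_ae hT Xu remainder_le.
have Su0 := bdd_linop_cvg0_ae hS Xu remainder_le.
have {}Tb := ae_foralln Tb.
near=> y.
have Tuy n : T (u n) y = T f y - \sum_(k < N n) a k * T (b k) y.
  by move: n; near: y.
have Suy n : S (u n) y = S f y - \sum_(k < N n) a k * S (b k) y.
  by move: n; near: y.
have Tby n : T (b n) y = g y * S (b n) y by move: n; near: y.
have Tuy0 : T (u n) y @[n --> \oo] --> 0 by near: y.
have Suy0 : S (u n) y @[n --> \oo] --> 0 by near: y.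
have diffE n : T (u n) y - g y * S (u n) y = T f y - g y * S f y.
  rewrite Tuy Suy mulrBr mulr_sumr.
  under eq_bigr do rewrite Tby mulrCA.
  by rewrite opprB addrA subrK.
have : T (u n) y - g y * S (u n) y @[n --> \oo] --> 0 - g y * 0.
  by apply: cvgB => //; exact: cvgMl_tmp.
rewrite (funext diffE) mulr0 subr0 => diff0.
apply/eqP; rewrite -subr_eq0; apply/eqP.
exact: (cvg_unique _ (cvg_cst _) diff0).
Unshelve. all: by end_near. Qed.

End Operators.

Theorem theorem4p2 (R : realType)
  (d1 : measure_display) (Om : measurableType d1) (mu : {measure set Om -> \bar R})
  (d2 : measure_display) (De : measurableType d2) (nu : {measure set De -> \bar R})
  (hmu : sigma_finite setT mu) (hnu : sigma_finite setT nu)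
  (X1 X2 : BFS mu) (Y1 Y2 : BFS nu)
  (sX1 : saturated mu (bfs_mem X1)) (sX2 : saturated mu (bfs_mem X2))
  (sY1 : saturated nu (bfs_mem Y1)) (sY2 : saturated nu (bfs_mem Y2))
  (T S : (Om -> R) -> (De -> R))
  (hT : bdd_linop X1 Y1 T) (hS : bdd_linop X2 Y2 S)
  (ntT : nontrivial_op nu X1 T) (ntS : nontrivial_op nu X2 S)
  (gamma : nat -> De -> R) (beta : nat -> Om -> R)
  (hgamma : schauder_basis (kdual_mem nu (bfs_mem Y1))
                              (kdual_norm nu (bfs_mem Y1) (bfs_enorm Y1)) gamma)
  (hbeta : schauder_basis (bfs_mem X1) (bfs_enorm X1) beta)
  (sY2Y1'' : saturated nu
     (mulsp_mem (bfs_mem Y2) (kdual_mem nu (kdual_mem nu (bfs_mem Y1)))))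
  (hoc : sigma_oc nu (bfs_mem Y2) (bfs_enorm Y2) \/
         sigma_oc nu (kdual_mem nu (bfs_mem Y1))
                     (kdual_norm nu (bfs_mem Y1) (bfs_enorm Y1)))
  (h : Om -> R) (hh : mulsp_mem (bfs_mem X1) (bfs_mem X2) h) :
  let M := mulsp_mem (bfs_mem Y2) (kdual_mem nu (kdual_mem nu (bfs_mem Y1))) in
  let Sb := fun j => S (fun x => h x * beta j x) in
  let cond_a := exists g, M g /\
      forall f, bfs_mem X1 f -> {ae nu, forall y, T f y = g y * S (fun x => h x * f x) y} in
  let cond_b := exists g, M g /\
      forall n, {ae nu, forall y, T (beta n) y = g y * Sb n y} in
  let cond_c := exists C : R, 0 < C /\
      forall (n m : nat) (r : nat -> nat -> R), (forall i j, `|r i j| <= 1) ->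
      (\sum_(i < n) \sum_(j < m)
          (r i j)%:E * \int[nu]_y (T (beta j) y * gamma i y)%R%:E <=
       C%:E * pi_norm nu (bfs_mem Y2) (bfs_enorm Y2)
                (kdual_mem nu (bfs_mem Y1)) (kdual_norm nu (bfs_mem Y1) (bfs_enorm Y1))
                (fun y => (\sum_(i < n) \sum_(j < m) r i j * Sb j y * gamma i y)%R))%E in
  let cond_d := exists C : R, 0 < C /\
      forall (n m : nat) (r : nat -> R), (forall j, `|r j| <= 1) ->
      (\sum_(j < m) (r j)%:E * \int[nu]_y (T (beta j) y * gamma n y)%R%:E <=
       C%:E * \int[nu]_y (`|\sum_(j < m) r j * Sb j y * gamma n y|%R)%:E)%E in
  [/\ cond_a <-> cond_b, cond_a <-> cond_c,
      (forall f, bfs_mem Y2 f -> kdual_mem nu (kdual_mem nu (bfs_mem Y1)) f) ->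
      (forall n m, n <> m -> {ae nu, forall y, gamma n y = 0 \/ gamma m y = 0}) ->
      cond_d -> cond_a &
      (forall f, bfs_mem Y2 f -> kdual_mem nu (kdual_mem nu (bfs_mem Y1)) f) ->
      (forall n m, n <> m -> {ae nu, forall y, gamma n y = 0 \/ gamma m y = 0}) ->
      (forall g, M g <-> Linf_mem nu g) ->
      cond_d <-> cond_a].
Proof.
move=> M Sb cond_a cond_b cond_c cond_d.
have idealY := bfs_ideal_space Y2.
have idealW := kdual_ideal_space (bfs_ideal_space Y1) hnu sY1.
have satW := kdual_saturated (bfs_ideal_space Y1) hnu sY1.
have hSh := bdd_linop_mulsp hS hh.
have [gammaW _] := hgamma; have [betaX _] := hbeta.
have TbW j : kdual_mem nu (kdual_mem nu (bfs_mem Y1)) (T (beta j)).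
  apply: (sub_kdual_kdual (bfs_ideal_space Y1)).
  by case: hT => TY _ _ _; exact: TY.
have SbY j : bfs_mem Y2 (Sb j) by case: hSh => SY _ _ _; exact: (SY (beta j)).
have ab : cond_a <-> cond_b.
  split=> [] [g [Mg Tg]]; exists g; split => //; first by move=> n; exact: Tg.
  exact: (factorization_on_basis hT hSh hbeta Tg).
have bc : cond_b <-> cond_c.
  split; first exact: (factors_pi_dominated idealY idealW TbW SbY gammaW).
  exact: (pi_dominated_factors idealY idealW hnu sY2 satW TbW SbY gammaW hgamma
    hoc).
have dc := L1_dominated_pi_dominated idealY idealW SbY gammaW
  (a := fun j => T (beta j)).
split; [exact: ab|by rewrite ab bc|by move=> Y2W disj /(dc Y2W disj)/bc/ab|].
move=> Y2W disj MLinf; split; first by move=> /(dc Y2W disj)/bc/ab.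
move=> /ab; apply: (factors_L1_dominated idealY idealW TbW SbY gammaW) => g.
by move/MLinf.
Qed.
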